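(* Let $M$ be an $n$-dimensional manifold and let $f_\lambda:M\to M$ be a family of homeomorphisms continuously depending on a parameter $\lambda\in[0,1]$. Suppose that $p\in M$ is an asymptotically stable fixed point for $f_0$ that undergoes a Hopf bifurcation at $\lambda=0$. Then there exists $\lambda_0>0$ such that for every $\lambda$ with $0<\lambda<\lambda_0$ there exists an attractor $K_\lambda$ of $f_\lambda$ which has the Borsuk's homotopy type (shape) of the sphere $S^{n-1}$, and $K_\lambda$ converges to $\{p\}$ upper semicontinuously as $\lambda$ tends to $0$.
   Context: Manifolds are topological manifolds (metrizable, without boundary). Continuous dependence on $\lambda$ means that $(x,\lambda)\mapsto f_\lambda(x)$ is continuous on $M\times[0,1]$. Attractors and repellers. For a homeomorphism $f:X\to X$ of a locally compact metric space and $Y\subset X$, let $\omega(Y)=\bigcap_{n>0}\overline{\bigcup_{k\ge n}f^k(Y)}$. A compactum $K\subset X$ is an attractor of $f$ if it has a neighborhood $U$ with $K=\omega(U)$. A compactum is a repeller of $f$ if it is an attractor of $f^{-1}$. A fixed point $p$ is asymptotically stable if $\{p\}$ is an attractor. Hopf bifurcation. If $K$ is an attractor of $f_0$, then $K$ undergoes a Hopf bifurcation at $\lambda=0$ if $K$ is a repeller of $f_\lambda$ for every $\lambda>0$. For a fixed point $p$ this is applied to $K=\{p\}$. Shape (Borsuk's homotopy type) is in the sense of Borsuk's shape theory for compact metric spaces: two compacta have the same shape if they are isomorphic in the shape category; equivalently, writing each as an inverse limit of a sequence of compact polyhedra, the two inverse sequences are isomorphic in the pro-category of the homotopy category of polyhedra.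 Upper semicontinuous convergence of $K_\lambda$ to $K$ as $\lambda\to0$: for every neighborhood $U$ of $K$ in $M$ there is $\lambda_U>0$ such that $K_\lambda\subset U$ for all $0<\lambda<\lambda_U$. *)

(* Defs.v *)
From HB Require Import structures.
From mathcomp Require Import all_boot all_order all_algebra.
From mathcomp Require Import all_classical all_reals all_analysis.

Set Implicit Arguments.
Unset Strict Implicit.
Unset Printing Implicit Defensive.

Import Order.TTheory GRing.Theory Num.Theory.
Import numFieldNormedType.Exports.

Local Open Scope classical_set_scope.
Local Open Scope ring_scope.

(* Subspaces are handled as sets, and maps between subspaces as total functions
   of which only the restriction to the source subspace matters. *)
Definition set_map (T U : topologicalType) (A : set T) (B : set U)
    (f : T -> U) : Prop :=
  {within A, continuous f} /\ (forall x, A x -> B (f x)).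

Definition homeomorphic_sets (T U : topologicalType) (A : set T) (B : set U) :
    Prop :=
  exists (f : T -> U) (g : U -> T),
    [/\ set_map A B f, set_map B A g,
        forall x, A x -> g (f x) = x &
        forall y, B y -> f (g y) = y].

Definition homotopic_maps (R : realType) (T U : topologicalType)
    (A : set T) (B : set U) (f g : T -> U) : Prop :=
  exists H : T * R -> U,
    [/\ set_map (A `*` `[(0 : R), 1]%classic) B H,
        forall x, A x -> H (x, 0) = f x &
        forall x, A x -> H (x, 1) = g x].

Definition manifold (R : realType) (n : nat) (M : metricType R) : Prop :=
  forall x : M, exists (U : set M) (V : set 'rV[R]_n),
    [/\ open U, U x, open V & homeomorphic_sets U V].

(* The unit sphere of R^n, i.e. S^(n-1); it is empty for n = 0. *)
Definition unit_sphere (R : realType) (n : nat) : set 'rV[R]_n :=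
  [set x | \sum_(i < n) x ord0 i ^+ 2 = 1].

Definition homeomorphism (T U : topologicalType) (f : T -> U) : Prop :=
  exists g : U -> T,
    [/\ continuous f, continuous g, cancel f g & cancel g f].

Definition omega_limit (T : topologicalType) (f : T -> T) (Y : set T) : set T :=
  \bigcap_(n in [set n : nat | (0 < n)%N])
    closure (\bigcup_(k in [set k : nat | (n <= k)%N]) (iter k f @` Y)).

Definition attractor (T : topologicalType) (f : T -> T) (K : set T) : Prop :=
  compact K /\ exists U : set T, set_nbhs K U /\ K = omega_limit f U.

Definition repeller (T : topologicalType) (f : T -> T) (K : set T) : Prop :=
  exists g : T -> T, [/\ cancel f g, cancel g f & attractor g K].

Definition asymptotically_stable (T : topologicalType) (f : T -> T) (p : T) :
    Prop :=
  f p = p /\ attractor f [set p].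

Definition hopf_bifurcation (R : realType) (T : topologicalType)
    (f : R -> T -> T) (K : set T) : Prop :=
  attractor (f 0) K /\ forall l : R, 0 < l <= 1 -> repeller (f l) K.

Definition convex_cell (R : realType) (N : nat) (s : seq 'rV[R]_N) :
    set 'rV[R]_N :=
  [set x | exists t : 'I_(size s) -> R,
    [/\ forall i, 0 <= t i, \sum_i t i = 1 & x = \sum_i t i *: s`_i]].

(* The Euclidean (PL) notion: a finite union of convex hulls of finite sets of
   points, equivalently the underlying space of a finite simplicial complex. *)
Definition compact_polyhedron (R : realType) (N : nat) (P : set 'rV[R]_N) :
    Prop :=
  exists cells : seq (seq 'rV[R]_N),
    P = [set x | exists2 s, s \in cells & convex_cell s x].

(* [ps_bond X i j] is the bonding map from the j-th to the i-th term; it is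
   meaningful only for i <= j. *)
Record poly_seq (R : realType) := PolySeq {
  ps_dim : nat -> nat;
  ps_space : forall i, set 'rV[R]_(ps_dim i);
  ps_bond : forall i j, 'rV[R]_(ps_dim j) -> 'rV[R]_(ps_dim i);
  ps_polyhedron : forall i, compact_polyhedron (@ps_space i);
  ps_bond_map : forall i j, (i <= j)%N ->
    set_map (@ps_space j) (@ps_space i) (@ps_bond i j);
  ps_bond_id : forall i x, @ps_space i x -> @ps_bond i i x = x;
  ps_bond_comp : forall i j k x, (i <= j)%N -> (j <= k)%N -> @ps_space k x ->
    @ps_bond i j (@ps_bond j k x) = @ps_bond i k x }.

Arguments ps_space {R} X i x : rename.
Arguments ps_bond {R} X i j x : rename.

Definition inverse_limit (R : realType) (X : poly_seq R) :
    set (prod_topology (fun i => 'rV[R]_(ps_dim X i))) :=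
  [set x | (forall i, ps_space X i (x i)) /\
           (forall i j, (i <= j)%N -> ps_bond X i j (x j) = x i)].

(* Representatives of elements of lim_j colim_i [X_i, Y_j]: the j-th component
   is the homotopy class of a map X_(pf_idx j) -> Y_j. *)
Record pro_fam (R : realType) (X Y : poly_seq R) := ProFam {
  pf_idx : nat -> nat;
  pf_map : forall j, 'rV[R]_(ps_dim X (pf_idx j)) -> 'rV[R]_(ps_dim Y j) }.

Arguments pf_map {R X Y} f j x : rename.

Definition pro_morphism (R : realType) (X Y : poly_seq R) (f : pro_fam X Y) :
    Prop :=
  (forall j, set_map (ps_space X (pf_idx f j)) (ps_space Y j)
               (pf_map f j)) /\
  (forall j j', (j <= j')%N -> exists i,
    [/\ (pf_idx f j <= i)%N, (pf_idx f j' <= i)%N &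
        homotopic_maps R (ps_space X i) (ps_space Y j)
          (pf_map f j \o ps_bond X (pf_idx f j) i)
          (ps_bond Y j j' \o pf_map f j' \o ps_bond X (pf_idx f j') i)]).

Definition pro_equiv (R : realType) (X Y : poly_seq R) (f g : pro_fam X Y) :
    Prop :=
  forall j, exists i,
    [/\ (pf_idx f j <= i)%N, (pf_idx g j <= i)%N &
        homotopic_maps R (ps_space X i) (ps_space Y j)
          (pf_map f j \o ps_bond X (pf_idx f j) i)
          (pf_map g j \o ps_bond X (pf_idx g j) i)].

Definition pro_id (R : realType) (X : poly_seq R) : pro_fam X X :=
  @ProFam _ X X id (fun _ => id).

Definition pro_comp (R : realType) (X Y Z : poly_seq R)
    (g : pro_fam Y Z) (f : pro_fam X Y) : pro_fam X Z :=
  @ProFam _ X Z (fun k => pf_idx f (pf_idx g k))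
    (fun k => pf_map g k \o pf_map f (pf_idx g k)).

Definition pro_isomorphic (R : realType) (X Y : poly_seq R) : Prop :=
  exists (f : pro_fam X Y) (g : pro_fam Y X),
    [/\ pro_morphism f, pro_morphism g,
        pro_equiv (pro_comp g f) (pro_id X) &
        pro_equiv (pro_comp f g) (pro_id Y)].

(* Equality of Borsuk shapes, by isomorphism of expansions in the pro-category of
   the homotopy category of polyhedra; for compact metrizable A and B, which always admit such expansions; the
   relation does not depend on the expansions chosen. *)
Definition same_shape (R : realType) (T U : topologicalType)
    (A : set T) (B : set U) : Prop :=
  exists X Y : poly_seq R,
    [/\ homeomorphic_sets A (@inverse_limit R X),
        homeomorphic_sets B (@inverse_limit R Y) &
        pro_isomorphic X Y].

Definition usc_at_zero (R : realType) (T : topologicalType) (K : R -> set T)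
    (K0 : set T) : Prop :=
  forall U : set T, set_nbhs K0 U ->
    exists2 lU : R, 0 < lU & forall l : R, 0 < l < lU -> K l `<=` U.

(* Main.v *)
Require Import Defs.
From HB Require Import structures.
From mathcomp Require Import all_boot all_order all_algebra.
From mathcomp Require Import all_classical all_reals all_analysis.
From mathcomp Require Import ring lra zify.

(** Stability of [p] under [f 0] provides a chart, parametrized by the cube,
    whose image [D] around [p] is carried into its own interior by all large
    iterates of [f 0] ([omega_limit_attracts]). As [D] is compact, finitely
    many of these inclusions survive for small [l], and enough of them generate
    all the later ones ([parameter_tube], [iter_trapping]). For [l > 0] the
    point [p] is a repeller of [F = f l], so some smaller concentric cube [B]
    is carried into its interior by all large iterates of the inverse of [F].
    Hence all large iterates of [F] carry the cubical annulus [A] between the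
    boundaries of [B] and [D] into the interior of [A]. The attractor [K l] is
    the omega-limit of [A]; it is the intersection of the decreasing sets
    [h^i(A)] for one large power [h] of [F] ([omega_limit_bigcap]). Being
    contained in every [F^j(D)], it shrinks to [p] because [f 0] contracts [D]
    to [p], once more by continuity in the parameter.

    The shape of [K l] is computed in the chart, where [h] becomes an embedding
    [theta] of the cube into itself that fixes [0] and carries the annulus [A]
    into its interior ([annulus_shape]). Put [N_i = theta^i(A)] and [D_i =
    theta^i(cube)] (the sets [shell i] and [disk i]). Finite unions of small
    cubes give polyhedra [P_i] between [N_{i+1}] and [N_i], so that [K l] is
    the limit of the [P_i] with inclusions as bonds. This sequence is compared
    with the constant sequence on the boundary of the cube, which is
    homeomorphic to the round sphere. One way, the map is the radial
    projection. For the other way, the radial retraction of the punctured cube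
    onto [A], conjugated by [theta^i], is a retraction of [D_i \ 0] onto [N_i],
    homotopic to the identity in [D_i \ 0]; applying it to a small sphere
    around [0] maps the sphere into [N_i].

    Most homotopies needed are then conjugates or images of radial ones. The
    exception is that the composite [N_i -> sphere -> N_i] is homotopic to the
    identity ([sphere_shell_radial]): radial segments from points of [N_i] may
    leave [D_i], which need not be star-shaped. So [D_i \ 0] is first
    contracted by [theta^i]-images of radial segments until it lies in a round
    ball inside [D_i]; there the radial projection onto a small sphere is
    harmless; finally the contraction is undone under the projection. *)

Set Implicit Arguments.
Unset Strict Implicit.
Unset Printing Implicit Defensive.

Import Order.TTheory GRing.Theory Num.Theory.
Import numFieldNormedType.Exports.

Local Open Scope classical_set_scope.
Local Open Scope ring_scope.

(** * Continuous maps between subsets, and their homotopies *)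

(** The filter form of [set_map]: composition, restriction and pairing become
    statements about limits along [within A]. *)
Lemma set_mapP (T U : topologicalType) (A : set T) (B : set U) (f : T -> U) :
  set_map A B f <->
  (forall x, A x -> f y @[y --> within A (nbhs x)] --> f x) /\
  (forall x, A x -> B (f x)).
Proof. by rewrite /set_map subspace_continuousP. Qed.

Section SetMaps.
Variables T U V : topologicalType.

Lemma set_map_comp (A : set T) (B : set U) (C : set V) (f : T -> U)
    (g : U -> V) :
  set_map A B f -> set_map B C g -> set_map A C (g \o f).
Proof.
move=> /set_mapP[fc fB] /set_mapP[gc gC]; apply/set_mapP; split; last first.
  by move=> x Ax; apply/gC/fB.
move=> x Ax; apply: (@cvg_comp _ _ _ f g _ (within B (nbhs (f x)))).
  move=> W /= /(fc _ Ax) WB; change (nbhs x (fun y => A y -> W (f y))).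
  change (nbhs x (fun y => A y -> B (f y) -> W (f y))) in WB.
  by apply: filterS WB => y WBy Ay; exact: WBy Ay (fB _ Ay).
by apply: gc; exact: fB.
Qed.

Lemma set_map_sub (A A' : set T) (B B' : set U) (f : T -> U) :
  A' `<=` A -> B `<=` B' -> set_map A B f -> set_map A' B' f.
Proof.
move=> AA BB [fc fB]; split; first exact: continuous_subspaceW fc.
by move=> x /AA/fB/BB.
Qed.

Lemma set_map_at (A : set T) (B : set U) (f : T -> U) :
  (forall x, A x -> {for x, continuous f}) -> (forall x, A x -> B (f x)) ->
  set_map A B f.
Proof.
move=> fc fB; apply/set_mapP; split=> // x Ax.
exact: cvg_comp (@cvg_within _ _ _ A) (fc _ Ax).
Qed.

Lemma set_map_eq (A : set T) (B : set U) (f g : T -> U) :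
  (forall x, A x -> f x = g x) -> set_map A B f -> set_map A B g.
Proof.
move=> fg /set_mapP[fc fB]; apply/set_mapP; split=> x Ax; last first.
  by rewrite -fg//; exact: fB.
rewrite -fg//; apply: cvg_trans (fc _ Ax); apply: fmap_within_eq => y.
by rewrite inE => /fg.
Qed.

Lemma set_map_pair (A : set T) (B : set U) (C : set V) f g :
  set_map A B f -> set_map A C g ->
  set_map A (B `*` C) (fun x => (f x, g x)).
Proof.
move=> /set_mapP[fc fB] /set_mapP[gc gC]; apply/set_mapP; split=> x Ax.
  exact: cvg_pair (fc _ Ax) (gc _ Ax).
by split; [exact: fB | exact: gC].
Qed.

Lemma set_map_open (A : set T) (B : set U) f x :
  open A -> set_map A B f -> A x -> {for x, continuous f}.
Proof.
move=> oA /set_mapP[fc _] Ax W /(fc _ Ax) H.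
change (nbhs x (fun y => A y -> W (f y))) in H.
by apply: filterS2 H (open_nbhs_nbhs (conj oA Ax)) => y; apply.
Qed.

End SetMaps.

Lemma continuous_pair (T U V : topologicalType) (f : T -> U) (g : T -> V) x :
  {for x, continuous f} -> {for x, continuous g} ->
  {for x, continuous (fun y => (f y, g y))}.
Proof. by move=> fc gc; exact: cvg_pair fc gc. Qed.

Lemma set_map_id (T : topologicalType) (A B : set T) :
  A `<=` B -> set_map A B id.
Proof. by move=> AB; apply: set_map_at => // x _; exact: cvg_id. Qed.

Lemma set_map_iter (T : topologicalType) (A : set T) f k :
  set_map A A f -> set_map A A (iter k f).
Proof.
move=> fA; elim: k => [|k IH]; first exact: set_map_id.
exact: set_map_comp IH fA.
Qed.

Lemma iter_fixed (T : Type) (g : T -> T) x k : g x = x -> iter k g x = x.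
Proof. by move=> gx; elim: k => //= k ->. Qed.

Lemma iter_cancel (T : Type) (F G : T -> T) k :
  cancel F G -> cancel (iter k F) (iter k G).
Proof. by move=> FK; elim: k => // k IH x; rewrite iterSr iterS FK IH. Qed.

Lemma iter_continuous (T : topologicalType) (g : T -> T) k : continuous g ->
  continuous (iter k g).
Proof.
move=> gc; elim: k => [|k IH] x; first exact: cvg_id.
exact: continuous_comp (IH x) (gc _).
Qed.

Section Homotopies.
Variable R : realType.
Local Notation I := `[(0 : R), 1]%classic.

Lemma homotopic_refl (T U : topologicalType) (A : set T) (B : set U) f g :
  set_map A B f -> (forall x, A x -> f x = g x) -> homotopic_maps R A B f g.
Proof.
move=> fAB fg; exists (f \o fst); split=> //.
apply: set_map_comp fAB; apply: set_map_at => [x _|[x t] []//].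
exact: cvg_fst.
Qed.

Lemma homotopic_ext (T U : topologicalType) (A : set T)
    (B : set U) (f g f' g' : T -> U) :
  homotopic_maps R A B f g -> (forall x, A x -> f x = f' x) ->
  (forall x, A x -> g x = g' x) -> homotopic_maps R A B f' g'.
Proof.
move=> [H [HB H0 H1]] ff gg; exists H; split=> // x Ax.
  by rewrite H0// ff.
by rewrite H1// gg.
Qed.

Lemma homotopic_post (T U V : topologicalType) (A : set T) (B : set U)
    (C : set V) (f g : T -> U) (u : U -> V) :
  set_map B C u -> homotopic_maps R A B f g ->
  homotopic_maps R A C (u \o f) (u \o g).
Proof.
move=> uBC [H [HB H0 H1]]; exists (u \o H); split.
- exact: set_map_comp HB uBC.
- by move=> x Ax /=; rewrite H0.
- by move=> x Ax /=; rewrite H1.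
Qed.

Lemma homotopic_pre (T U V : topologicalType) (A : set T) (B : set U)
    (C : set V) (f g : U -> V) (u : T -> U) :
  set_map A B u -> homotopic_maps R B C f g ->
  homotopic_maps R A C (f \o u) (g \o u).
Proof.
move=> uAB [H [HC H0 H1]]; have [_ uB] := uAB.
exists (fun z => H (u z.1, z.2)); split=> [|x Ax|x Ax] /=.
- apply: (@set_map_comp _ _ _ _ (B `*` I) _ (fun z : T * R => (u z.1, z.2)) H).
  + apply: set_map_pair.
      apply: (@set_map_comp _ _ _ _ A _ fst u) => //.
      by apply: set_map_at => [x _|[x t] []//]; exact: cvg_fst.
    by apply: set_map_at => [x _|[x t] []//]; exact: cvg_snd.
  + exact: HC.
- by rewrite H0//; exact: uB.
- by rewrite H1//; exact: uB.
Qed.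

Lemma homotopic_sub (T U : topologicalType) (A : set T) (B B' : set U) f g :
  B `<=` B' -> homotopic_maps R A B f g -> homotopic_maps R A B' f g.
Proof.
by move=> BB [H [HB H0 H1]]; exists H; split=> //; exact: set_map_sub HB.
Qed.

Lemma homotopic_sym (T U : topologicalType) (A : set T) (B : set U) f g :
  homotopic_maps R A B f g -> homotopic_maps R A B g f.
Proof.
move=> [H [HB H0 H1]]; exists (fun z => H (z.1, 1 - z.2)); split.
- apply: (@set_map_comp _ _ _ _ (A `*` I) _ (fun z : T * R => (z.1, 1 - z.2)) H)
    => //.
  apply: set_map_at.
    move=> z _; apply: continuous_pair; first exact: cvg_fst.
    by apply: cvgB; [exact: cvg_cst | exact: cvg_snd].
  move=> [x t] [/= Ax]; rewrite !in_itv/= => /andP[t0 t1].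
  by split=> //; apply/andP; split; lra.
- by move=> x Ax /=; rewrite subr0 H1.
- by move=> x Ax /=; rewrite subrr H0.
Qed.

(** Closedness of the source lets the two halves of the concatenated homotopy
    be glued along closed pieces. *)
Lemma homotopic_trans (T U : topologicalType) (A : set T) (B : set U) f g h :
  closed A -> homotopic_maps R A B f g -> homotopic_maps R A B g h ->
  homotopic_maps R A B f h.
Proof.
move=> cA [H [HB H0 H1]] [G [GB G0 G1]].
pose K (z : T * R) :=
  if z.2 <= 2^-1 then H (z.1, 2 * z.2) else G (z.1, 2 * z.2 - 1).
pose I1 := `[(0 : R), 2^-1]%classic; pose I2 := `[(2^-1 : R), 1]%classic.
have cprod (J : set R) : closed J -> closed (A `*` J).
  move=> cJ; rewrite (_ : A `*` J = (fst @^-1` A) `&` (snd @^-1` J))//.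
  apply: closedI; apply: closed_comp => // z _; [exact: cvg_fst|exact: cvg_snd].
have K1 : set_map (A `*` I1) B K.
  apply: (@set_map_eq _ _ _ _ (fun z : T * R => H (z.1, 2 * z.2))).
    by move=> [x t] [_]; rewrite /I1/= in_itv/= /K/= => /andP[_ ->].
  apply: (@set_map_comp _ _ _ _ (A `*` I) _ (fun z : T * R => (z.1, 2 * z.2)) H)
    => //.
  apply: set_map_at.
    move=> z _; apply: continuous_pair; first exact: cvg_fst.
    by apply: cvgMr; exact: cvg_snd.
  move=> [x t] [/= Ax]; rewrite /I1/= !in_itv/= => /andP[t0 t1].
  by split=> //; apply/andP; split; lra.
have K2 : set_map (A `*` I2) B K.
  apply: (@set_map_eq _ _ _ _ (fun z : T * R => G (z.1, 2 * z.2 - 1))).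
    move=> [x t] [/= Ax]; rewrite /I2/= in_itv/= /K/= => /andP[t2 _].
    case: ifPn => // t1; have -> : t = 2^-1 by lra.
    by rewrite divff// subrr G0// H1.
  apply: (@set_map_comp _ _ _ _ (A `*` I) _
    (fun z : T * R => (z.1, 2 * z.2 - 1)) G) => //.
  apply: set_map_at.
    move=> z _; apply: continuous_pair; first exact: cvg_fst.
    by apply: cvgB; [apply: cvgMr; exact: cvg_snd|exact: cvg_cst].
  move=> [x t] [/= Ax]; rewrite /I2/= !in_itv/= => /andP[t0 t1].
  by split=> //; apply/andP; split; lra.
exists K; split.
- have -> : A `*` I = (A `*` I1) `|` (A `*` I2).
    rewrite /I1 /I2; apply/seteqP; split=> -[x t] /=; rewrite !in_itv/=.
      move=> [Ax /andP[t0 t1]].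
      by have [th|th] := lerP t 2^-1; [left|right]; split=> //; lra.
    by move=> [] [Ax /andP[t0 t1]]; split=> //; lra.
  split; last by move=> z [] Az; [apply K1|apply K2].
  apply: withinU_continuous K1.1 K2.1; apply: cprod; exact: itv_closed.
- by move=> x Ax; rewrite /K/= ifT ?mulr0 ?H0//; lra.
- move=> x Ax; rewrite /K/= ifF; last by apply/negbTE; lra.
  by rewrite (_ : 2 * 1 - 1 = 1) ?G1//; lra.
Qed.

(** Every homotopy below is built from these straight-line ones by composition
    and concatenation. *)
Lemma homotopic_line (T : topologicalType) (V : normedModType R) (A : set T)
    (B : set V) (f g : T -> V) :
  set_map A B f -> set_map A B g ->
  (forall x t, A x -> 0 <= t <= 1 -> B ((1 - t) *: f x + t *: g x)) ->
  homotopic_maps R A B f g.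
Proof.
move=> fAB gAB lB.
exists (fun z => (1 - z.2) *: f z.1 + z.2 *: g z.1); split.
- apply/set_mapP; split; last first.
    by move=> [x t] [/= Ax]; rewrite in_itv/=; exact: lB.
  move=> [x t] [/= Ax It].
  have fstA (h : T -> V) : set_map A B h ->
      h z.1 @[z --> within (A `*` I) (nbhs (x, t))] --> h x.
    move=> hAB.
    have /set_mapP[+ _] : set_map (A `*` I) B (h \o fst).
      apply: set_map_comp hAB; apply: set_map_at => [z _|z []//].
      exact: cvg_fst.
    exact.
  have sndc : z.2 @[z --> within (A `*` I) (nbhs (x, t))] --> t.
    exact: cvg_comp (@cvg_within _ _ _ _) (@cvg_snd _ _ _ _ _).
  apply: cvgD; apply: cvgZ; [|exact: fstA| |exact: fstA] => //.
  by apply: cvgB => //; exact: cvg_cst.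
- by move=> x Ax; rewrite subr0 scale1r scale0r addr0.
- by move=> x Ax; rewrite subrr scale1r scale0r add0r.
Qed.

End Homotopies.

(** * Boxes as polyhedra *)

Section Boxes.
Variables (R : realType) (n : nat).
Implicit Types (a b : 'I_n -> R) (x y : 'rV[R]_n).

Lemma row_norm_le (z : 'rV[R]_n) (r : R) : 0 <= r ->
  (`|z| <= r) <-> (forall i, `|z ord0 i| <= r).
Proof.
move=> r0; rewrite [`|z|]mx_normrE; split=> [/bigmax_leP[_ H] i|H].
  exact: (H (ord0, i)).
by apply/bigmax_leP; split=> // -[i j] _ /=; rewrite ord1.
Qed.

Lemma row_norm_attained (z : 'rV[R]_n) :
  `|z| != 0 -> exists i, `|z| = `|z ord0 i|.
Proof. by move=> /mx_norm_neq0[[i j] /=]; rewrite (ord1 i); exists j. Qed.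

(** Degenerate sides [a i = b i] are allowed, so that faces of a cube are boxes
    too. *)
Definition box a b : set 'rV[R]_n :=
  [set y | forall i, a i <= y ord0 i <= b i].

Definition box_vertices a b : seq 'rV[R]_n :=
  [seq \row_i (if e i then b i else a i) | e : {ffun 'I_n -> bool}].

Lemma convex_cell_image (I : finType) (v : I -> 'rV[R]_n) (t : I -> R) :
  (forall i, 0 <= t i) -> \sum_i t i = 1 ->
  convex_cell [seq v i | i : I] (\sum_i t i *: v i).
Proof.
move=> t0 t1; set s := [seq v i | i : I].
have sz : #|I| = size s by rewrite size_map -cardE.
pose h (i : I) : 'I_(size s) := cast_ord sz (enum_rank i).
pose h' (k : 'I_(size s)) : I := enum_val (cast_ord (esym sz) k).
have hK : cancel h h' by move=> i; rewrite /h /h' cast_ordK enum_rankK.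
have h'K : cancel h' h by move=> k; rewrite /h /h' enum_valK cast_ordKV.
have hb : {on [pred k : 'I_(size s) | true], bijective h}.
  by apply: onW_bij; exists h'.
exists (t \o h'); split=> [k||] /=.
- exact: t0.
- by rewrite (reindex h)//= -t1; apply: eq_bigr => i _; rewrite hK.
- rewrite (reindex h)//=; apply: eq_bigr => i _; rewrite hK; congr (_ *: _).
  rewrite (nth_map i) ?nth_enum_rank// -cardE; exact: ltn_ord.
Qed.

(** The point of a box with relative coordinates [u i] is the average of the
    vertices weighted by the product law of independent coins of bias [u i]. *)
Lemma box_convex_cell a b :
  (forall i, a i <= b i) -> convex_cell (box_vertices a b) = box a b.
Proof.
move=> ab; apply/seteqP; split=> y; last first.
  move=> yab; pose u i := (y ord0 i - a i) / (b i - a i).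
  have u01 i : 0 <= u i <= 1.
    have /andP[ay yb] := yab i.
    have [e|d] := eqVneq (b i) (a i); first by
      rewrite /u e subrr invr0 mulr0 lexx ler01.
    have ba : 0 < b i - a i by rewrite subr_gt0 lt_neqAle eq_sym d ab.
    by rewrite /u divr_ge0 ?subr_ge0// ?(ltW ba)//= ler_pdivrMr// mul1r lerB.
  have uy i : u i * b i + (1 - u i) * a i = y ord0 i.
    have /andP[ay yb] := yab i.
    rewrite (_ : _ + _ = a i + u i * (b i - a i)); last by ring.
    have [e|d] := eqVneq (b i) (a i).
      by rewrite e subrr mulr0 addr0; apply/eqP; rewrite eq_le ay -e yb.
    by rewrite /u divfK ?subr_eq0// addrC subrK.
  pose F i (c : bool) := if c then u i else 1 - u i.
  have sum_bool (G : bool -> R) : \sum_c G c = G true + G false.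
    by rewrite big_bool.
  have -> : y = \sum_(e : {ffun 'I_n -> bool}) (\prod_i F i (e i)) *:
      \row_i (if e i then b i else a i).
    apply/rowP => j; rewrite summxE.
    (* Coordinate [j] of the average is again a product of sums: the factor [j]
       averages the two ends of that side, all other factors are 1. *)
    pose G i (c : bool) := F i c *
      (if i == j then (if c then b i else a i) else 1).
    transitivity (\prod_i \sum_c G i c).
      have Gij i : i != j -> \sum_c G i c = 1.
        by move=> /negbTE ij; rewrite sum_bool /G /F ij !mulr1 addrC subrK.
      rewrite (bigD1 j)//= (_ : \prod_(i | i != j) _ = 1); last exact: big1.
      by rewrite mulr1 sum_bool /G /F eqxx.
    rewrite bigA_distr_bigA; apply: eq_bigr => e _.
    rewrite !mxE /G big_split/=; congr (_ * _).
    by rewrite (bigD1 j)//= eqxx big1 ?mulr1// => i /negbTE ->.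
  apply: convex_cell_image => [e|].
    apply: prodr_ge0 => i _; have /andP[u0 u1] := u01 i.
    by rewrite /F; case: ifP => _ //; rewrite subr_ge0.
  rewrite -(bigA_distr_bigA F) big1// => i _.
  by rewrite sum_bool /F addrC subrK.
move=> [t [t0 t1 ->]] i; rewrite summxE.
have vb (k : 'I_(size (box_vertices a b))) :
    a i <= (box_vertices a b)`_k ord0 i <= b i.
  have /mapP[e _ ->] := mem_nth 0 (ltn_ord k).
  by rewrite mxE; case: ifP => _; rewrite ?lexx ?ab.
apply/andP; split.
  rewrite -[leLHS]mul1r -t1 mulr_suml; apply: ler_sum => k _.
  by rewrite mxE ler_wpM2l//; case/andP: (vb k).
rewrite -[leRHS]mul1r -t1 mulr_suml; apply: ler_sum => k _.
by rewrite mxE ler_wpM2l//; case/andP: (vb k).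
Qed.

Lemma closed_ball_box x (r : R) : 0 <= r ->
  [set y | `|x - y| <= r] =
  box (fun i => x ord0 i - r) (fun i => x ord0 i + r).
Proof.
move=> r0; apply/seteqP; split=> y.
  move=> /(row_norm_le _ r0) H i; have := H i.
  by rewrite !mxE ler_norml => /andP[? ?]; apply/andP; split; lra.
move=> H; apply/(row_norm_le _ r0) => i; have /andP[? ?] := H i.
by rewrite !mxE ler_norml; apply/andP; split; lra.
Qed.

(** A compact set is covered by finitely many cubes inside a given
    neighbourhood, cubes being the balls of the sup norm. *)
Lemma polyhedron_between (C O : set 'rV[R]_n) :
  compact C -> open O -> C `<=` O ->
  exists P, [/\ compact_polyhedron P, closed P, C `<=` P & P `<=` O].
Proof.
rewrite compact_cover => cC oO CO.
pose D := [set z : 'rV[R]_n * R |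
  0 < z.2 /\ [set y | `|z.1 - y| <= z.2] `<=` O].
have [s sD Cs] : exists2 s : seq ('rV[R]_n * R), (forall z, z \in s -> D z) &
    forall x, C x -> exists2 z, z \in s & `|z.1 - x| < z.2.
  have [||D' D'D CD'] := cC ('rV[R]_n * R)%type D
    (fun z : 'rV[R]_n * R => ball z.1 z.2).
  - by move=> z [z0 _]; exact: ball_open.
  - move=> x Cx.
    have /nbhs_ballP[e /= e0 eO] := open_nbhs_nbhs (conj oO (CO _ Cx)).
    exists (x, e / 2); last by apply: ballxx; rewrite /= divr_gt0.
    split=> /=; first by rewrite divr_gt0.
    move=> y /= xy; apply: eO; rewrite -ball_normE/=.
    by apply: le_lt_trans xy _; rewrite ltr_pdivrMr// ltr_pMr// ltr1n.
  exists (finmap.enum_fset D') => [z /D'D|x /CD'[z zD']]; first by rewrite inE.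
  by rewrite -ball_normE/= => xz; exists z.
pose cell (z : 'rV[R]_n * R) :=
  box_vertices (fun i => z.1 ord0 i - z.2) (fun i => z.1 ord0 i + z.2).
have cellE z : z \in s -> convex_cell (cell z) = [set y | `|z.1 - y| <= z.2].
  move=> /sD[z0 _]; rewrite box_convex_cell ?(closed_ball_box _ (ltW z0))//.
  move=> i.
  by rewrite lerD2l (le_trans _ (ltW z0))// oppr_le0 ltW.
exists [set y | exists2 t, t \in [seq cell z | z <- s] & convex_cell t y];
  split.
- by exists [seq cell z | z <- s].
- rewrite (_ : mkset _ = \bigcup_(z in [set` s]) [set y | `|z.1 - y| <= z.2]).
    apply: closed_bigcup; first exact: finite_seq.
    by move=> z _; exact: closed_closed_ball_.
  apply/seteqP; split=> y /=.
    by move=> [t /mapP[z zs ->]]; rewrite cellE// => zy; exists z.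
  by move=> [z /= zs zy]; exists (cell z); [exact: map_f | rewrite cellE].
- move=> x /Cs[z zs zx]; exists (cell z); first exact: map_f.
  by rewrite cellE//=; exact: ltW.
- by move=> y [t /mapP[z zs ->]]; rewrite cellE// => /(sD _ zs).2.
Qed.

Definition cube_sphere : set 'rV[R]_n := [set x | `|x| = 1].

(** This is the boundary of the cube, whose faces are boxes degenerate in one
    coordinate. *)
Lemma cube_sphere_polyhedron : compact_polyhedron cube_sphere.
Proof.
pose lo (p : 'I_n * bool) j : R := if j == p.1 then (-1) ^+ p.2 else -1.
pose hi (p : 'I_n * bool) j : R := if j == p.1 then (-1) ^+ p.2 else 1.
have cellE p : convex_cell (box_vertices (lo p) (hi p)) = box (lo p) (hi p).
  apply: box_convex_cell => i; rewrite /lo /hi; case: ifP => // _; lra.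
exists [seq box_vertices (lo p) (hi p) | p : 'I_n * bool].
apply/seteqP; split=> x /=.
  move=> x1; have [|i xi] := @row_norm_attained x;
    first by rewrite x1 oner_neq0.
  have xle j : `|x ord0 j| <= 1 by apply: (row_norm_le x ler01).1; rewrite x1.
  pose p := (i, x ord0 i < 0).
  exists (box_vertices (lo p) (hi p)); first by apply: map_f; rewrite mem_enum.
  rewrite cellE => j; rewrite /lo /hi/=; case: eqVneq => [->|_].
    rewrite x1 in xi; have : x ord0 i = (-1) ^+ (x ord0 i < 0)%R * `|x ord0 i|.
      by rewrite [LHS]numEsign.
    by rewrite -xi mulr1 => <-; rewrite lexx.
  by rewrite -ler_norml.
move=> [s /mapP[[i e] _ ->]]; rewrite cellE => H.
have xi : `|x ord0 i| = 1.
  have := H i; rewrite /lo /hi/= eqxx -eq_le => /eqP <-.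
  by rewrite normrX normrN1 expr1n.
apply/eqP; rewrite eq_le; apply/andP; split; last first.
  by rewrite -xi; apply: (row_norm_le x (normr_ge0 x)).1.
apply/(row_norm_le x ler01) => j.
have [->|ji] := eqVneq j i; first by rewrite xi.
by have := H j; rewrite /lo /hi/= (negbTE ji) ler_norml.
Qed.

End Boxes.

(** * Homeomorphisms, nested sequences and spheres *)

Lemma homeomorphic_trans (T U V : topologicalType) (A : set T) (B : set U)
    (C : set V) :
  homeomorphic_sets A B -> homeomorphic_sets B C -> homeomorphic_sets A C.
Proof.
move=> [f [g [fc gc fg gf]]] [h [k [hc kc hk kh]]].
exists (h \o f), (g \o k); split.
- exact: set_map_comp fc hc.
- exact: set_map_comp kc gc.
- by move=> x Ax /=; rewrite hk ?fg//; exact: fc.2.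
- by move=> y Cy /=; rewrite gf ?kh//; exact: kc.2.
Qed.

Lemma same_shape_homeomorphic (R : realType) (T U V W : topologicalType)
    (A : set T) (A' : set V) (B : set U) (B' : set W) :
  homeomorphic_sets A A' -> homeomorphic_sets B B' ->
  same_shape R A' B' -> same_shape R A B.
Proof.
move=> AA BB [X [Y [AX BY XY]]]; exists X, Y.
by split=> //; [exact: homeomorphic_trans AX|exact: homeomorphic_trans BY].
Qed.

Lemma homeomorphic_refl (T : topologicalType) (A : set T) :
  homeomorphic_sets A A.
Proof. by exists id, id; split=> //; exact: set_map_id. Qed.

Section NestedSequence.
Variables (R : realType) (n : nat) (P : nat -> set 'rV[R]_n).
Hypothesis P_poly : forall i, compact_polyhedron (P i).
Hypothesis P_dec : forall i j, (i <= j)%N -> P j `<=` P i.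

Definition nested_poly_seq : poly_seq R :=
  @PolySeq R (fun=> n) P (fun _ _ => id) P_poly
    (fun i j ij => set_map_id (P_dec ij)) (fun _ _ _ => erefl)
    (fun _ _ _ _ _ _ _ => erefl).

Lemma nested_inverse_limit :
  homeomorphic_sets (\bigcap_i P i) (@inverse_limit R nested_poly_seq).
Proof.
pose E := prod_topology (fun i => 'rV[R]_(ps_dim nested_poly_seq i)).
exists (fun x _ => x), (fun z : E => z 0%N); split.
- apply: set_map_at => x Px; last by split=> // i; exact: Px.
  apply/cvg_sup; first exact/fmap_filter/nbhs_filter.
  move=> i; move: x {Px};
  apply/(@continuousP _ (initial_topology (fun f : E => f i))).
  by move=> A [B oB <-].
- apply: (@set_map_at _ _ (@inverse_limit R nested_poly_seq) (\bigcap_i P i)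
     (fun z : E => z 0%N)) => [z _|z [zP zz] i _].
    exact: (@proj_continuous _ (fun i => 'rV[R]_(ps_dim nested_poly_seq i))
      0%N).
  by have <- := zz 0%N i (leq0n _); exact: zP.
- by [].
- move=> z [_ zz]; apply: functional_extensionality_dep => i.
  by have <- := zz 0%N i (leq0n _).
Qed.

End NestedSequence.

Section Spheres.
Variables (R : realType) (n : nat).
Local Notation E := 'rV[R]_n.

(** Projection onto the unit sphere of the sup norm, that is, onto the boundary
    of the cube. *)
Definition radial (x : E) : E := `|x|^-1 *: x.

Lemma radial_continuous (x : E) : x != 0 -> {for x, continuous radial}.
Proof.
move=> x0; apply: (@continuousZ _ _ _ (fun y : E => `|y|^-1) id);
  last exact: cvg_id.
by apply: continuousV; [rewrite normr_eq0|exact: norm_continuous].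
Qed.

Lemma norm_radial (x : E) : x != 0 -> `|radial x| = 1.
Proof.
by move=> x0; rewrite normrZ normfV normr_id mulVf// normr_eq0.
Qed.

Lemma radialZ (t : R) (x : E) : 0 < t -> radial (t *: x) = radial x.
Proof.
move=> t0; rewrite /radial normrZ gtr0_norm// scalerA invfM mulrAC mulVf
  ?mul1r//.
exact: lt0r_neq0.
Qed.

Lemma radial_unit (x : E) : `|x| = 1 -> radial x = x.
Proof. by move=> x1; rewrite /radial x1 invr1 scale1r. Qed.

Lemma norm1_neq0 (x : E) : `|x| = 1 -> x != 0.
Proof. by move=> x1; rewrite -normr_eq0 x1 oner_neq0. Qed.

Definition euclidean_norm (x : E) : R := Num.sqrt (\sum_i x ord0 i ^+ 2).

Lemma euclidean_norm_continuous : continuous euclidean_norm.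
Proof.
move=> x; apply: continuous_comp; last exact: sqrt_continuous.
apply: (@continuous_big _ _ _ _ _ (@add_continuous _)) => i _ y.
by apply: continuousM; exact: coord_continuous.
Qed.

Lemma euclidean_norm_gt0 (x : E) : x != 0 -> 0 < euclidean_norm x.
Proof.
move=> x0; have [|i xi] := @row_norm_attained R n x; first by rewrite normr_eq0.
rewrite sqrtr_gt0 (bigD1 i)//= ltr_pwDl//.
  by rewrite exprn_even_gt0//= -normr_eq0 -xi normr_eq0.
by apply: sumr_ge0 => j _; exact: sqr_ge0.
Qed.

Lemma euclidean_norm_scale (t : R) (x : E) : 0 <= t ->
  euclidean_norm (t *: x) = t * euclidean_norm x.
Proof.
move=> t0; rewrite /euclidean_norm (eq_bigr (fun i => t ^+ 2 * x ord0 i ^+ 2)).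
  by rewrite -mulr_sumr sqrtrM ?sqr_ge0// sqrtr_sqr ger0_norm.
by move=> i _; rewrite mxE exprMn.
Qed.

Lemma unit_sphere_euclidean_norm (x : E) :
  unit_sphere x <-> euclidean_norm x = 1.
Proof.
rewrite /unit_sphere/= /euclidean_norm; split=> [->|e]; first exact: sqrtr1.
have sge0 : 0 <= \sum_i x ord0 i ^+ 2 by apply: sumr_ge0 => i _; exact: sqr_ge0.
by rewrite -(sqr_sqrtr sge0) e expr1n.
Qed.

Lemma unit_sphere_neq0 (x : E) : unit_sphere x -> x != 0.
Proof.
move=> /unit_sphere_euclidean_norm x1; apply/eqP => x0; move/eqP: x1;
  rewrite x0.
by rewrite -(scale0r 0) euclidean_norm_scale// mul0r eq_sym oner_eq0.
Qed.

Lemma unit_sphere_cube_sphere :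
  homeomorphic_sets (@unit_sphere R n) (@cube_sphere R n).
Proof.
exists radial, (fun x => (euclidean_norm x)^-1 *: x); split.
- apply: set_map_at => x /unit_sphere_neq0; first exact: radial_continuous.
  exact: norm_radial.
- apply: set_map_at => x /norm1_neq0 x0.
    apply: (@continuousZ _ _ _ (fun y => (euclidean_norm y)^-1) id);
      last exact: cvg_id.
    by apply: continuousV;
      [exact/lt0r_neq0/euclidean_norm_gt0|exact: euclidean_norm_continuous].
  apply/unit_sphere_euclidean_norm; rewrite euclidean_norm_scale ?mulVf//;
    first exact/lt0r_neq0/euclidean_norm_gt0.
  by rewrite invr_ge0 ltW// euclidean_norm_gt0.
- move=> x Sx; have x0 := unit_sphere_neq0 Sx.
  rewrite euclidean_norm_scale ?invr_ge0// (unit_sphere_euclidean_norm x).1//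
    mulr1 invrK scalerA.
  by rewrite divff ?scale1r// normr_eq0.
- move=> x Sx; have x0 := norm1_neq0 Sx.
  by rewrite radialZ ?radial_unit// invr_gt0 euclidean_norm_gt0.
Qed.

End Spheres.

(** * Shape of the nested images of an annulus *)

Section Cubes.
Variables (R : realType) (n : nat).
Local Notation E := 'rV[R]_n.

Definition cube : set E := [set z | `|z| <= 1].
Definition open_cube : set E := [set z | `|z| < 1].
Definition annulus (s : R) : set E := [set z | s <= `|z| <= 1].
Definition open_annulus (s : R) : set E := [set z | s < `|z| < 1].

Lemma open_cube_cube : open_cube `<=` cube.
Proof. by move=> z; exact: ltW. Qed.

Lemma open_cube0 : open_cube 0.
Proof. by rewrite /open_cube/= normr0. Qed.

Lemma cube0 : cube 0.
Proof. by rewrite /cube/= normr0. Qed.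

Lemma open_cube_open : open open_cube.
Proof.
rewrite (_ : open_cube = Num.norm @^-1` [set t : R | t < 1])//.
by apply: open_comp (@open_lt R 1) => z _; exact: norm_continuous.
Qed.

Lemma open_annulus_open s : open (open_annulus s).
Proof.
rewrite (_ : open_annulus s = Num.norm @^-1` `]s, 1[%classic).
  apply: open_comp; last exact: itv_open.
  by move=> z _; exact: norm_continuous.
by apply/seteqP; split=> z /=; rewrite in_itv/=.
Qed.

Lemma cube_sphere_closed : closed (@cube_sphere R n).
Proof.
rewrite (_ : @cube_sphere R n = Num.norm @^-1` [set 1]); last first.
  by apply/seteqP; split=> x.
apply: closed_comp; first by move=> x _; exact: norm_continuous.
exact: closed_eq.
Qed.

Lemma cube_compact : compact cube.
Proof.
apply: bounded_closed_compact.
  exists 1; split; first exact: num_real.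
  by move=> r r1 z Qz; exact: le_trans Qz (ltW r1).
rewrite (_ : cube = Num.norm @^-1` [set t : R | t <= 1])//.
by apply: closed_comp (@closed_le R 1) => z _; exact: norm_continuous.
Qed.

Lemma annulus_compact s : compact (annulus s).
Proof.
apply: subclosed_compact cube_compact _; last by move=> z /andP[].
rewrite (_ : annulus s = Num.norm @^-1` `[s, 1]%classic).
  apply: closed_comp; last exact: itv_closed.
  by move=> z _; exact: norm_continuous.
by apply/seteqP; split=> z /=; rewrite in_itv/=.
Qed.

End Cubes.

Section AnnulusMap.
Variables (R : realType) (n : nat).
Local Notation E := 'rV[R]_n.
Local Notation cube := (@cube R n).
Local Notation open_cube := (@open_cube R n).

Variables (theta zeta : E -> E) (s : R).
Hypothesis s01 : 0 < s < 1.
Hypothesis theta_map : set_map cube cube theta.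
Hypothesis zeta_map : set_map (theta @` cube) cube zeta.
Hypothesis thetaK : forall z, cube z -> zeta (theta z) = z.
Hypothesis theta0 : theta 0 = 0.
Hypothesis theta_in : forall z, open_cube z -> open_cube (theta z).
Hypothesis theta_open : forall O : set E,
  open O -> O `<=` open_cube -> open (theta @` O).
Hypothesis theta_annulus : forall z,
  @annulus R n s z -> @open_annulus R n s (theta z).

Local Notation A := (@annulus R n s).
Local Notation Ao := (@open_annulus R n s).
Local Notation S := (@cube_sphere R n).

Let s0 : 0 < s. Proof. by case/andP: s01. Qed.
Let s1 : s < 1. Proof. by case/andP: s01. Qed.

Definition punctured_cube : set E := [set z | cube z /\ z != 0].

(** The radial retraction of the punctured cube onto the annulus: it pushes the
    vectors shorter than [s] out to norm [s]. *)
Definition clamp (z : E) : E := (Num.max s `|z| / `|z|) *: z.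

Definition eta i : E -> E := iter i theta.
Definition disk i : set E := eta i @` cube.
Definition punctured_disk i : set E := [set y | disk i y /\ y != 0].
Definition shell i : set E := eta i @` A.
Definition shell_retraction i : E -> E := eta i \o clamp \o iter i zeta.

Lemma annulus_punctured_cube : A `<=` punctured_cube.
Proof.
move=> z /andP[sz z1]; split=> //.
by rewrite -normr_gt0; exact: lt_le_trans sz.
Qed.

Lemma eta_map i : set_map cube cube (eta i).
Proof. exact: set_map_iter. Qed.

Lemma etaK i z : cube z -> iter i zeta (eta i z) = z.
Proof.
elim: i z => // i IH z Qz; rewrite iterSr /eta iterS thetaK ?IH//.
exact: (eta_map i).2.
Qed.

Lemma etaKV i y : disk i y -> eta i (iter i zeta y) = y.
Proof. by move=> [z Qz <-]; rewrite etaK. Qed.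

Lemma eta0 i : eta i 0 = 0.
Proof. by elim: i => //= i; rewrite /eta/= => ->. Qed.

Lemma iter_zeta_map i : set_map (disk i) cube (iter i zeta).
Proof.
elim: i => [|i IH]; first by apply: set_map_id => _ [z Qz <-].
apply: (@set_map_eq _ _ _ _ (iter i zeta \o zeta)).
  by move=> y _; rewrite iterSr.
have [zc zQ] := zeta_map; apply: set_map_comp IH.
split; last first.
  move=> _ [z Qz <-]; exists z => //; rewrite /eta iterS thetaK//.
  exact: (eta_map i).2.
apply: continuous_subspaceW zc => _ [z Qz <-]; exists (eta i z) => //.
exact: (eta_map i).2.
Qed.

Lemma disk_dec i j : (i <= j)%N -> disk j `<=` disk i.
Proof.
move=> ij _ [z Qz <-]; exists (eta (j - i) z); first exact: (eta_map _).2.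
by rewrite /eta -iterD subnKC.
Qed.

Lemma punctured_disk_dec i j : (i <= j)%N ->
  punctured_disk j `<=` punctured_disk i.
Proof. by move=> ij y [Dy y0]; split=> //; exact: disk_dec Dy. Qed.

Lemma shell_dec i j : (i <= j)%N -> shell j `<=` shell i.
Proof.
move=> ij _ [z Az <-]; exists (eta (j - i) z);
  last by rewrite /eta -iterD subnKC.
elim: (j - i)%N => //= k /theta_annulus /andP[? ?].
by apply/andP; split; exact: ltW.
Qed.

Lemma eta_punctured_cube i : set_map punctured_cube (punctured_disk i) (eta i).
Proof.
split; first by apply: continuous_subspaceW (eta_map i).1 => z [].
move=> z [Qz z0]; split; first by exists z.
apply: contraNneq z0 => e; rewrite -(etaK i Qz) e.
by have := etaK i (@cube0 R n); rewrite eta0 => ->.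
Qed.

Lemma iter_zeta_punctured i :
  set_map (punctured_disk i) punctured_cube (iter i zeta).
Proof.
split; first by apply: continuous_subspaceW (iter_zeta_map i).1 => z [].
move=> y [Dy y0]; split; first exact: (iter_zeta_map i).2.
by apply: contraNneq y0 => e; rewrite -(etaKV Dy) e eta0.
Qed.

Lemma shell_punctured_disk i : shell i `<=` punctured_disk i.
Proof.
by move=> _ [z /annulus_punctured_cube Az <-]; exact: (eta_punctured_cube i).2.
Qed.

Lemma norm_clamp z : z != 0 -> `|clamp z| = Num.max s `|z|.
Proof.
move=> z0; have nz : 0 < `|z| by rewrite normr_gt0.
have m0 : 0 < Num.max s `|z| by rewrite lt_max s0.
by rewrite normrZ normrM normfV normr_id (gtr0_norm m0) divfK// gt_eqF.
Qed.

Lemma clamp_map : set_map punctured_cube A clamp.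
Proof.
apply: set_map_at => z [Qz z0].
  apply: (@continuousZ _ _ _ (fun y : E => Num.max s `|y| / `|y|) id);
    last exact: cvg_id.
  apply: continuousM; last by apply: continuousV;
    [rewrite normr_eq0|exact: norm_continuous].
  apply: (@continuous_max _ _ (fun=> s) (fun y : E => `|y|));
    first exact: cst_continuous.
  exact: norm_continuous.
by rewrite /annulus/= norm_clamp// le_max lexx ge_max (ltW s1).
Qed.

Lemma clamp_id z : A z -> clamp z = z.
Proof.
move=> Az; have [_ z0] := annulus_punctured_cube Az; have /andP[sz _] := Az.
by rewrite /clamp (max_idPr sz) divff ?scale1r// normr_eq0.
Qed.

Lemma shell_retraction_map i :
  set_map (punctured_disk i) (shell i) (shell_retraction i).
Proof.
apply: set_map_comp (iter_zeta_punctured i) _; apply: set_map_comp clamp_map _.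
split; last by move=> z Az; exists z.
by apply: continuous_subspaceW (eta_map i).1 => z /andP[].
Qed.

Lemma shell_retraction_id i y : shell i y -> shell_retraction i y = y.
Proof.
move=> [z Az <-]; rewrite /shell_retraction/= etaK ?clamp_id//.
by have [] := annulus_punctured_cube Az.
Qed.

(** The segment from [z] to a positive multiple of [z] misses the origin. *)
Lemma homotopic_punctured_cube (f : E -> E) (c : E -> R) :
  set_map punctured_cube punctured_cube f ->
  (forall z, punctured_cube z -> 0 < c z /\ f z = c z *: z) ->
  homotopic_maps R punctured_cube punctured_cube id f.
Proof.
move=> fm fc; apply: homotopic_line => //; first exact: set_map_id.
move=> z t Pz /andP[t0 t1]; have [c0 fz] := fc _ Pz; have [Qz z0] := Pz.
split; last first.
  rewrite fz scalerA -scalerDl scaler_eq0 negb_or z0 andbT gt_eqF//.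
  have [->|tn] := eqVneq t 0; first by rewrite mul0r subr0 addr0.
  have tp : 0 < t by rewrite lt_def tn.
  by rewrite ltr_wpDl// ?subr_ge0// mulr_gt0.
have [Qf _] := fm.2 _ Pz; rewrite /cube/= in Qz Qf *.
rewrite (le_trans (ler_normD _ _))// !normrZ (ger0_norm t0) ger0_norm
  ?subr_ge0//.
have : t * `|f z| <= t by rewrite ler_piMr.
have : (1 - t) * `|z| <= 1 - t by rewrite ler_piMr// subr_ge0.
lra.
Qed.

(** Conjugation by [theta^i] transports radial homotopies of the punctured cube
    to the punctured disk [D_i \ 0], which need not be star-shaped. *)
Lemma homotopic_punctured_disk i (f : E -> E) (c : E -> R) :
  set_map punctured_cube punctured_cube f ->
  (forall z, punctured_cube z -> 0 < c z /\ f z = c z *: z) ->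
  homotopic_maps R (punctured_disk i) (punctured_disk i) id
    (eta i \o f \o iter i zeta).
Proof.
move=> fm fc; have H := homotopic_punctured_cube fm fc.
apply: homotopic_ext (homotopic_pre (iter_zeta_punctured i)
  (homotopic_post (eta_punctured_cube i) H)) _ _ => // y [Dy _] /=.
exact: etaKV.
Qed.

Lemma homotopic_shell_retraction i :
  homotopic_maps R (punctured_disk i) (punctured_disk i) id
    (shell_retraction i).
Proof.
apply: (@homotopic_punctured_disk i clamp (fun z => Num.max s `|z| / `|z|)).
  exact: set_map_sub (@annulus_punctured_cube) clamp_map.
move=> z [_ z0]; split=> //.
by rewrite divr_gt0 ?normr_gt0// lt_max s0.
Qed.

Lemma eta_open i (O : set E) : open O -> O `<=` open_cube ->
  open (eta i @` O) /\ eta i @` O `<=` open_cube.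
Proof.
move=> oO OQ; elim: i => [|i [oi iQ]]; first by rewrite /eta/= image_id.
split; last first.
  by move=> _ [z Oz <-]; apply: theta_in; apply: iQ; exists z.
by rewrite (_ : eta i.+1 = theta \o eta i)// -image_comp; exact: theta_open.
Qed.

(** The disks are neighbourhoods of the origin because [theta] is open. *)
Lemma disk_ball i : exists2 d : R, 0 < d & forall y, `|y| <= d -> disk i y.
Proof.
have [oD _] := @eta_open i _ (@open_cube_open R n) (@subset_refl _ _).
have : nbhs (0 : E) (eta i @` open_cube).
  apply: open_nbhs_nbhs; split=> //; exists 0; last exact: eta0.
  by rewrite /open_cube/= normr0.
move=> /nbhs_ballP[e /= e0 eD]; exists (e / 2); first by rewrite divr_gt0.
move=> y ye; have [|z Qz <-] := eD y; last by exists z => //; exact: ltW.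
rewrite -ball_normE/= sub0r normrN; apply: le_lt_trans ye _.
by rewrite ltr_pdivrMr// ltr_pMr// ltr1n.
Qed.

Lemma eta_small i (d : R) : 0 < d ->
  exists2 e : R, 0 < e <= 1 & forall z, cube z -> `|eta i (e *: z)| <= d.
Proof.
move=> d0; have em : set_map open_cube cube (eta i).
  by apply: set_map_sub (eta_map i) => // z; exact: ltW.
have nd : nbhs (eta i 0) [set y | `|y| <= d].
  rewrite eta0; apply/nbhs_ballP; exists d => //= y.
  by rewrite -ball_normE/= sub0r normrN; exact: ltW.
have Q0 : open_cube 0 by rewrite /open_cube/= normr0.
have /nbhs_ballP[e /= e0 eD] := set_map_open (@open_cube_open R n) em Q0 nd.
have m0 : 0 < Num.min e 1 by rewrite lt_min e0 ltr01.
have m1 : Num.min e 1 <= 1 by rewrite ge_min lexx orbT.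
have me : Num.min e 1 <= e by rewrite ge_min lexx.
exists (Num.min e 1 / 2).
  rewrite divr_gt0//=; lra.
move=> z Qz; apply: eD; rewrite -ball_normE/= sub0r normrN normrZ.
rewrite gtr0_norm ?divr_gt0//.
have : Num.min e 1 / 2 * `|z| <= Num.min e 1 / 2 by rewrite ler_piMr// ltW//
  divr_gt0.
lra.
Qed.

Section SphereMaps.
Variable d : nat -> R.
Hypothesis d0 : forall i, 0 < d i.
Hypothesis dD : forall i y, `|y| <= d i -> disk i y.

(** A sphere of radius [d i] lies in [D_i \ 0], and the retraction carries it
    into the shell; this represents the class of a map from the sphere to
    [N_i]. *)
Definition sphere_shell i (x : E) : E := shell_retraction i (d i *: x).

Lemma scale_sphere i : set_map S (punctured_disk i) (fun x => d i *: x).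
Proof.
apply: set_map_at => [x _|x Sx]; first exact: scaler_continuous.
split; last by rewrite scaler_eq0 negb_or (norm1_neq0 Sx) gt_eqF.
by apply: dD; rewrite normrZ Sx mulr1 gtr0_norm.
Qed.

Lemma sphere_shell_map i : set_map S (shell i) (sphere_shell i).
Proof. exact: set_map_comp (scale_sphere i) (shell_retraction_map i). Qed.

Lemma radial_punctured_disk i : set_map (punctured_disk i) S (@radial R n).
Proof.
by apply: set_map_at => x [_ x0]; [exact: radial_continuous|exact: norm_radial].
Qed.

(** The radius may be changed from [d i] to [d j] along radial segments inside
    the larger of the two balls; then the retraction onto the smaller shell
    [N_j] is homotopic to the identity in [D_j \ 0], and the retraction onto
    [N_i] fixes [N_j]. *)
Lemma sphere_shell_coherent i j : (i <= j)%N ->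
  homotopic_maps R S (shell i) (sphere_shell i) (sphere_shell j).
Proof.
move=> ij; pose sc k : E -> E := fun x => d k *: x.
have H1 : homotopic_maps R S (shell i)
    (shell_retraction i \o sc i) (shell_retraction i \o sc j).
  apply: (homotopic_post (shell_retraction_map i)); apply: homotopic_line.
  + exact: scale_sphere.
  + apply: set_map_sub (scale_sphere j) => //; exact: punctured_disk_dec.
  + move=> x t Sx /andP[t0 t1]; rewrite !scalerA -scalerDl.
    have di := d0 i; have dj := d0 j.
    set c := (1 - t) * d i + t * d j.
    have c0 : 0 < c.
      rewrite /c; have [->|tn] := eqVneq t 0;
        first by rewrite subr0 mul1r mul0r addr0.
      by rewrite ltr_wpDl ?mulr_ge0 ?subr_ge0 ?(ltW di)// mulr_gt0// lt_def tn.
    split; last by rewrite scaler_eq0 negb_or (norm1_neq0 Sx) gt_eqF.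
    have cx : `|c *: x| = c by rewrite normrZ Sx mulr1 gtr0_norm.
    have [dij|dji] := leP (d j) (d i).
      apply: dD; rewrite cx /c.
      have : t * d j <= t * d i by rewrite ler_wpM2l.
      lra.
    apply: (disk_dec ij); apply: dD; rewrite cx /c.
    have : (1 - t) * d i <= (1 - t) * d j by rewrite ler_wpM2l ?subr_ge0// ltW.
    lra.
have H2 : homotopic_maps R S (shell i)
    (shell_retraction i \o sc j) (sphere_shell j).
  have H := homotopic_pre (scale_sphere j) (homotopic_shell_retraction j).
  have := homotopic_post (shell_retraction_map i)
    (homotopic_sub (@punctured_disk_dec _ _ ij) H).
  move=> /homotopic_ext; apply=> // x Sx /=.
  by rewrite shell_retraction_id//; apply: (shell_dec ij);
    exact: (sphere_shell_map j).2.
exact: homotopic_trans (@cube_sphere_closed R n) H1 H2.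
Qed.

(** The retraction is homotopic to the identity away from the origin, and the
    radial projection undoes the scaling by [d i]. *)
Lemma radial_sphere_shell i :
  homotopic_maps R S S (@radial R n \o sphere_shell i) id.
Proof.
apply: homotopic_sym; have H := homotopic_pre (scale_sphere i)
  (homotopic_shell_retraction i).
have := homotopic_post (radial_punctured_disk i) H.
move=> /homotopic_ext; apply=> // x Sx /=.
by rewrite radialZ// radial_unit.
Qed.

(** In the punctured disk, [x] is homotopic to [u x], which lies in the ball of
    radius [d i]; there it is homotopic to its projection [v (u x)] onto the
    small sphere, and this is homotopic to [v x] since [u] is homotopic to the
    identity. Applying the retraction, which fixes [P], gives the result. *)
Lemma sphere_shell_radial i (P : set E) : closed P -> P `<=` shell i ->
  homotopic_maps R P (shell i) (sphere_shell i \o @radial R n) id.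
Proof.
move=> cP Pr; have [e /andP[e0 e1] eD] := eta_small i (d0 i).
have PD : P `<=` punctured_disk i by move=> x /Pr; exact: shell_punctured_disk.
have Pm := set_map_id PD.
pose sc (z : E) := e *: z.
have scm : set_map punctured_cube punctured_cube sc.
  apply: set_map_at => [z _|z [Qz z0]]; first exact: scaler_continuous.
  split; last by rewrite scaler_eq0 negb_or z0 gt_eqF.
  by rewrite /cube/= normrZ gtr0_norm// mulr_ile1// ltW.
pose u := eta i \o sc \o iter i zeta.
have Hu : homotopic_maps R (punctured_disk i) (punctured_disk i) id u.
  by apply: (@homotopic_punctured_disk i sc (fun=> e)).
have um : set_map (punctured_disk i) (punctured_disk i) u.
  exact: set_map_comp (iter_zeta_punctured i)
    (set_map_comp scm (eta_punctured_cube i)).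
pose v x := d i *: @radial R n x.
have vm : set_map (punctured_disk i) (punctured_disk i) v.
  exact: set_map_comp (radial_punctured_disk i) (scale_sphere i).
(* The segment from [u x] to [v (u x)] is radial and stays in the ball of
   radius [d i]. *)
have Huv : homotopic_maps R (punctured_disk i) (punctured_disk i) u (v \o u).
  apply: homotopic_line => //; first exact: set_map_comp um vm.
  move=> x t Dx /andP[t0 t1]; have [_ u0] := um.2 _ Dx.
  have ud : `|u x| <= d i by apply: eD; exact: (iter_zeta_map i).2 _ Dx.1.
  rewrite /= /v /radial !scalerA -scalerDl.
  have nu : 0 < `|u x| by rewrite normr_gt0.
  set c := 1 - t + _.
  have c0 : 0 < c.
    rewrite /c; have [->|tn] := eqVneq t 0; first by rewrite subr0 !mul0r addr0.
    by rewrite ltr_wpDl ?subr_ge0// !mulr_gt0 ?invr_gt0// lt_def tn.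
  split; last by rewrite scaler_eq0 negb_or u0 gt_eqF.
  apply: dD; rewrite normrZ gtr0_norm// /c mulrDl divfK ?gt_eqF//.
  have : (1 - t) * `|u x| <= (1 - t) * d i by rewrite ler_wpM2l ?subr_ge0.
  lra.
have H1 := homotopic_pre Pm Hu.
have H2 := homotopic_pre Pm Huv.
have H3 := homotopic_pre Pm (homotopic_post vm (homotopic_sym Hu)).
have H := homotopic_trans cP H1 (homotopic_trans cP H2 H3).
have := homotopic_post (shell_retraction_map i) (homotopic_sym H).
move=> /homotopic_ext; apply=> // x Px /=.
by apply: shell_retraction_id; exact: Pr.
Qed.

End SphereMaps.

Lemma shell_compact i : compact (shell i).
Proof.
apply: continuous_compact (@annulus_compact R n s).
by apply: continuous_subspaceW (eta_map i).1 => z /andP[].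
Qed.

(** The maps [radial] and [sphere_shell] are inverse isomorphisms between the
    sequence of the [P_i] and the constant sequence on the boundary of the
    cube. *)
Theorem annulus_shape : same_shape R (\bigcap_i shell i) (@unit_sphere R n).
Proof.
have /choice[P PP] : forall i, exists P : set E,
    [/\ compact_polyhedron P, closed P, shell i.+1 `<=` P & P `<=` shell i].
  move=> i.
  (* Openness of [theta^i] leaves room for a polyhedron between two consecutive
     shells. *)
  have AoQ : Ao `<=` open_cube by move=> z /andP[].
  have [oA _] := @eta_open i _ (@open_annulus_open R n s) AoQ.
  have [|P [Pp Pc rP Pa]] := polyhedron_between (@shell_compact i.+1) oA.
    move=> _ [z Az <-]; exists (theta z); first exact: theta_annulus.
    by rewrite /eta -iterSr.
  exists P; split=> // y /Pa[z /andP[sz z1] <-]; exists z => //.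
  by apply/andP; split; exact: ltW.
have Pp i : compact_polyhedron (P i) by have [] := PP i.
have Pc i : closed (P i) by have [] := PP i.
have rP i : shell i.+1 `<=` P i by have [] := PP i.
have Pr i : P i `<=` shell i by have [] := PP i.
have Pdec i j : (i <= j)%N -> P j `<=` P i.
  rewrite leq_eqVlt => /predU1P[->//|ij] y /Pr ry.
  by apply/rP; exact: shell_dec ry.
have /choice[d dd] : forall i, exists d : R,
    0 < d /\ forall y, `|y| <= d -> disk i y.
  by move=> i; have [d ? ?] := disk_ball i; exists d.
have d0 i := (dd i).1; have dD i := (dd i).2.
pose X := nested_poly_seq Pp Pdec.
pose Y := @nested_poly_seq R n (fun=> S) (fun=> cube_sphere_polyhedron R n)
  (fun i j _ => @subset_refl _ S).
exists X, Y; split.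
- have -> : \bigcap_i shell i = \bigcap_i P i; last exact: nested_inverse_limit.
  apply/seteqP; split=> y yr i _; last exact: Pr (yr i I).
  by apply: rP; exact: yr.
- apply: homeomorphic_trans (unit_sphere_cube_sphere R n) _.
  have -> : @cube_sphere R n = \bigcap_(i : nat) S;
    last exact: (@nested_inverse_limit R n (fun=> S)).
  by rewrite bigcap_const//; exists 0%N.
(* [P_j] contains [N_{j+1}] but need not contain [N_j]; hence the shift of
   index. *)
pose f : pro_fam X Y := @ProFam R X Y (fun=> 0%N) (fun _ => @radial R n).
pose g : pro_fam Y X := @ProFam R Y X (fun=> 0%N)
  (fun j => sphere_shell d j.+1).
have fm i : set_map (P i) S (@radial R n).
  apply: set_map_sub (radial_punctured_disk i) => //.
  by move=> y /Pr; exact: shell_punctured_disk.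
exists f, g; split.
- split=> [j|j j' jj']; first exact: fm.
  exists 0%N; split=> //; apply: homotopic_refl => //; exact: fm.
- split=> [j|j j' jj'].
    by apply: set_map_sub (sphere_shell_map d0 dD j.+1) => //; exact: rP.
  exists 0%N; split=> //.
  by apply: homotopic_sub (@rP j) _; exact: sphere_shell_coherent.
- move=> k; exists k.+1; split=> //.
  apply: homotopic_sub (@rP k) _.
  exact: (sphere_shell_radial d0 dD (Pc k.+1) (@Pr k.+1)).
- move=> j; exists j; split=> //.
  exact: (radial_sphere_shell d0 dD 1).
Qed.

End AnnulusMap.

(** * Charts and attraction *)

Section Charts.
Variables (R : realType) (n : nat) (M : metricType R).
Local Notation E := 'rV[R]_n.
Local Notation cube := (@cube R n).
Local Notation open_cube := (@open_cube R n).

(** A closed cube with centre [p], parametrized by [e] with inverse [c]. The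
    last clause records that the cube sits in an open chart domain, whose
    charts are open maps. *)
Definition cube_chart (p : M) (e : E -> M) (c : M -> E) : Prop :=
  [/\ e 0 = p, set_map cube (e @` cube) e, set_map (e @` cube) cube c,
      forall z, cube z -> c (e z) = z &
      forall O : set E, open O -> O `<=` open_cube -> open (e @` O)].

Lemma cube_chart_nbhs p e c (O : set E) : cube_chart p e c -> open O -> O 0 ->
  O `<=` open_cube -> nbhs p (e @` O).
Proof.
move=> [e0 _ _ _ eo] oO O0 OQ; apply: open_nbhs_nbhs; split; first exact: eo.
by exists 0.
Qed.

Lemma cube_chart_at p e c z : cube_chart p e c -> open_cube z ->
  {for z, continuous e}.
Proof.
move=> [_ em _ _ _] Qz.
apply: (@set_map_open _ _ open_cube setT) Qz; first exact: open_cube_open.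
by apply: set_map_sub em => //; exact: open_cube_cube.
Qed.

Lemma cube_chart_scale p e c (s : R) : cube_chart p e c -> 0 < s <= 1 ->
  cube_chart p (fun z => e (s *: z)) (fun x => s^-1 *: c x).
Proof.
move=> [e0 em cm ce eo] /andP[s0 s1].
have sm : set_map cube cube ( *:%R s).
  apply: set_map_at => [z _|z Qz]; first exact: scaler_continuous.
  by rewrite /cube/= normrZ gtr0_norm// mulr_ile1// ltW.
split.
- by rewrite scaler0.
- have := set_map_comp sm em; case=> ec _; split=> // z Qz; exists z => //.
- split; last first.
    move=> _ [z Qz <-]; rewrite ce; last exact: sm.2.
    by rewrite scalerA mulVf ?scale1r// gt_eqF.
  have [] // : set_map [set e (s *: z) | z in cube] setT (fun x => s^-1 *: c x).
  apply: set_map_comp (set_map_at (A := cube) _ _); last first.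
  + by [].
  + by move=> z _; exact: scaler_continuous.
  + apply: set_map_sub cm => // _ [z Qz <-]; exists (s *: z) => //.
    exact: sm.2.
- move=> z Qz; rewrite ce; last exact: sm.2.
  by rewrite scalerA mulVf ?scale1r// gt_eqF.
- move=> O oO OQ; rewrite -(image_comp ( *:%R s) e); apply: eo.
    rewrite (_ : [set _ | _ in _] = ( *:%R s^-1) @^-1` O).
      by apply: open_comp => // z _; exact: scaler_continuous.
    apply/seteqP; split=> [_ [z Oz <-]|z Oz].
      by rewrite /preimage/mkset scalerA mulVf ?scale1r// gt_eqF.
    have sz : s *: (s^-1 *: z) = z by rewrite scalerA divff ?scale1r// gt_eqF.
    by exists (s^-1 *: z); [exact: Oz|exact: sz].
  move=> _ [z /OQ Qz <-]; rewrite /open_cube/= normrZ gtr0_norm//.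
  have : s * `|z| <= `|z| by rewrite ler_piMl.
  by move/le_lt_trans; apply.
Qed.

Hypothesis M_manifold : manifold n M.

(** A small cube around the image of [p] in a chart fits into the preimage of
    [W]. *)
Lemma cube_chart_exists (p : M) (W : set M) : nbhs p W ->
  exists e c, cube_chart p e c /\ forall z, cube z -> W (e z).
Proof.
move=> nW; have [U [V [oU Up oV [phi [psi [phim psim phiK psiK]]]]]] :=
  M_manifold p.
pose v := phi p; have Vv : V v by exact: phim.2.
have psic := set_map_open oV psim Vv.
have nVW : nbhs v (V `&` psi @^-1` W).
  apply: filterI; first exact: open_nbhs_nbhs.
  by apply: psic; rewrite /v phiK.
have /nbhs_ballP[d /= d0 dVW] := nVW.
pose r := d / 2; have r0 : 0 < r by rewrite divr_gt0.
have rd : r < d by rewrite ltr_pdivrMr// ltr_pMr// ltr1n.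
pose t (z : E) := v + r *: z.
have tVW z : cube z -> (V `&` psi @^-1` W) (t z).
  move=> Qz; apply: dVW; rewrite -ball_normE/= opprD addNKr normrN normrZ
    gtr0_norm//.
  by apply: le_lt_trans rd; rewrite ler_piMr// ltW.
have tc : continuous t.
  move=> z; apply: (@continuousD _ _ _ (fun=> v) ( *:%R r)).
    exact: cst_continuous.
  exact: scaler_continuous.
pose c x := r^-1 *: (phi x - v).
have ct z : cube z -> c (psi (t z)) = z.
  move=> /tVW[Vt _]; rewrite /c psiK// /t addrC addKr scalerA mulVf ?scale1r//.
  by rewrite gt_eqF.
have cU x : U x -> {for x, continuous c}.
  move=> Ux; have phic := set_map_open oU phim Ux.
  apply: (@continuous_comp _ _ _ (fun x => phi x - v) ( *:%R r^-1)).
    by apply: (@continuousB _ _ _ phi (fun=> v)) => //; exact: cst_continuous.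
  exact: scaler_continuous.
have tU z : cube z -> U (psi (t z)) by move=> /tVW[/psim.2].
exists (psi \o t), c; split; last by move=> z /tVW[].
split.
- by rewrite /= /t scaler0 addr0 /v phiK.
- have tm : set_map cube V t by apply: set_map_at => [z _|z /tVW[]//];
    exact: tc.
  by have [ec _] := set_map_comp tm psim; split=> // z Qz; exists z.
- apply: set_map_at => _ [z Qz <-]; first exact/cU/tU.
  by rewrite /= ct.
- exact: ct.
- move=> O oO OQ; rewrite openE => _ [z Oz <-].
  have Qz : cube z by exact/open_cube_cube/OQ.
  have Ue := tU _ Qz; have nc : nbhs (c (psi (t z))) O.
    by rewrite ct//; exact: open_nbhs_nbhs.
  change (nbhs (psi (t z)) ((psi \o t) @` O)).
  have nO : nbhs (psi (t z)) (c @^-1` O) := cU _ Ue _ nc.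
  have nU : nbhs (psi (t z)) U by exact: open_nbhs_nbhs.
  apply: filterS2 nO nU => x /= Ox Ux.
  exists (c x) => //=; rewrite /t /c scalerA divff ?gt_eqF// scale1r.
  by rewrite addrC subrK phiK.
Qed.

Lemma cube_chart_compact p e c (D : set E) : cube_chart p e c ->
  compact D -> D `<=` cube -> compact (e @` D).
Proof.
move=> [_ em _ _ _] cD DQ; apply: continuous_compact => //.
exact: continuous_subspaceW em.1.
Qed.

Lemma metric_compact_closed (D : set M) : compact D -> closed D.
Proof. by apply: compact_closed; exact: metric_hausdorff. Qed.

(** An omega-limit of a continuous map is forward invariant. *)
Lemma omega_limit_fixed (g : M -> M) (U : set M) p :
  continuous g -> [set p] = omega_limit g U -> g p = p.
Proof.
move=> gc pU; have wp : omega_limit g U p by rewrite -pU.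
suff : omega_limit g U (g p) by rewrite -pU.
move=> i i0 B /(gc p) /(wp i i0)[x [[k ik [y Uy <-]] Bx]].
exists (g (iter k g y)); split=> //; exists k.+1; last by exists y.
by rewrite /= (leq_trans ik).
Qed.

(** As the space may fail to be compact, a decreasing sequence of closed sets
    with intersection [{p}] need not enter [W]: orbits might escape to
    infinity. But such sets eventually miss a small sphere around [p], which is
    compact, and the iterates of the cube are connected and contain [p], so
    they stay inside that sphere. *)
Lemma omega_limit_attracts (g : M -> M) (U W : set M) p e c :
  continuous g -> [set p] = omega_limit g U -> cube_chart p e c ->
  (forall z, cube z -> U (e z)) -> nbhs p W ->
  exists k0, forall k z, (k0 <= k)%N -> cube z -> W (iter k g (e z)).
Proof.
move=> gc pU ech eU nW; have gp := omega_limit_fixed gc pU.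
have [e' [c' [ech' eW']]] := cube_chart_exists nW.
have [e0 em _ _ _] := ech; have [e0' em' cm' ce' eo'] := ech'.
pose Sg := e' @` @cube_sphere R n.
have SQ : @cube_sphere R n `<=` cube by move=> z;
  rewrite /cube_sphere/cube/= => ->.
have cS : compact Sg.
  apply: (cube_chart_compact ech') => //.
  apply: (subclosed_compact _ (@cube_compact R n)) => //.
  exact: cube_sphere_closed.
pose tail k := \bigcup_(j in [set j | (k <= j)%N]) (iter j g @` U).
have [k0 _ k0P] : \forall k \near \oo, Sg `<=` ~` tail k.
  apply: ((compact_near_coveringP Sg).1 cS nat \oo%classic
    (fun k x => (~` tail k) x)).
  move=> _ [z Sz <-]; have zp : ~ omega_limit g U (e' z).
    rewrite -pU => /= ez; have := norm1_neq0 Sz; apply/negP/negPn/eqP.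
    by rewrite -(ce' _ (SQ _ Sz)) ez -e0' ce'//; exact: cube0.
  have [m /= m0 mB] : exists2 m, (0 < m)%N & ~ closure (tail m) (e' z).
    apply: contrapT => H; apply: zp => i i0; apply: contrapT => Hi.
    by apply: H; exists i.
  have nB : nbhs (e' z) (~` tail m).
    apply: contrapT => H; apply: mB => B nB.
    apply: contrapT => HB; apply: H; apply: filterS nB => x Bx Tx.
    by apply: HB; exists x.
  exists ((~` tail m), [set k | (m <= k)%N]).
    by split=> //; exists m.
  move=> [x k] [/= nTx mk] [j kj jU]; apply: nTx; exists j => //=.
  exact: leq_trans kj.
exists k0 => k z kk Qz.
(* The iterated segment from the centre to [z] starts at [p] and never crosses
   the sphere. *)
pose gam (t : R) := iter k g (e (t *: z)).
have tQ t : `[(0 : R), 1]%classic t -> cube (t *: z).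
  rewrite /= in_itv/= => /andP[t0 t1].
  by rewrite /cube/= normrZ ger0_norm// mulr_ile1.
have gamm : set_map `[(0 : R), 1]%classic (setT : set M) gam.
  have lm : set_map `[(0 : R), 1]%classic cube (fun t : R => t *: z).
    by apply: set_map_at => [t _|t /tQ//]; exact: scalel_continuous.
  have gm : set_map (e @` cube) setT (iter k g).
    by apply: set_map_at => // x _; exact: iter_continuous.
  exact: set_map_comp (set_map_comp lm em) gm.
have Cc : connected (gam @` `[(0 : R), 1]%classic).
  exact: connected_continuous_connected (@segment_connected R 0 1) gamm.1.
have CS x : (gam @` `[(0 : R), 1]%classic) x -> ~ Sg x.
  move=> [t It <-] Sx; apply: (k0P k kk _ Sx); exists k => //=.
  by exists (e (t *: z)) => //; exact/eU/tQ.
pose B := gam @` `[(0 : R), 1]%classic `&` e' @` open_cube.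
have BC : B = gam @` `[(0 : R), 1]%classic.
  apply: Cc.
  - exists p; split; last by exists 0 => //; exact: open_cube0.
    exists 0; first by rewrite /= in_itv/= lexx ler01.
    by rewrite /gam scale0r e0 iter_fixed.
  - exists (e' @` open_cube) => //; apply: eo' => //; exact: open_cube_open.
  - exists (e' @` cube).
      apply: metric_compact_closed; apply: (cube_chart_compact ech') => //.
      exact: cube_compact.
    apply/seteqP; split=> x [Cx [w Qw ew]]; split=> //; exists w => //.
      exact: open_cube_cube.
    rewrite /open_cube/= lt_neqAle; apply/andP; split=> //.
    by apply: contra_notN (CS _ Cx) => /eqP w1; exists w.
have : B (gam 1).
  by rewrite BC; exists 1 => //; rewrite /= in_itv/= lexx ler01.
rewrite /gam scale1r => -[_ [w Qw <-]].
exact/eW'/open_cube_cube.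
Qed.

End Charts.

(** * The attractor of a trapped annulus *)

Section Dynamics.
Variables (R : realType) (n : nat) (M : metricType R).
Local Notation E := 'rV[R]_n.
Local Notation cube := (@cube R n).
Local Notation open_cube := (@open_cube R n).

(** From time [j + m] on, all the iterates of [A] lie in the closed set
    [F^j(A)]. *)
Lemma omega_limit_sub (F : M -> M) (A : set M) m j : continuous F ->
  compact A -> (forall k x, (m <= k)%N -> A x -> A (iter k F x)) ->
  omega_limit F A `<=` iter j F @` A.
Proof.
move=> Fc cA Am x wx.
have cl : closed (iter j F @` A).
  apply: metric_compact_closed; apply: continuous_compact cA.
  by apply: continuous_subspaceT; exact: iter_continuous.
apply: cl; apply: closure_subset (wx (j + m).+1 isT) => _ [k /= jk [y Ay <-]].
have jk' : (j + m <= k)%N by exact: ltnW.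
exists (iter (k - j) F y); last by
  rewrite -iterD subnKC// (leq_trans (leq_addr _ _) jk').
by apply: Am => //; rewrite leq_subRL// (leq_trans (leq_addr _ _) jk').
Qed.

Lemma omega_limit_bigcap (F : M -> M) (A : set M) m : continuous F ->
  (0 < m)%N -> compact A ->
  (forall k x, (m <= k)%N -> A x -> A (iter k F x)) ->
  omega_limit F A = \bigcap_i (iter i (iter m F) @` A).
Proof.
move=> Fc m0 cA Am; apply/seteqP; split=> x.
  move=> wx i _; have := @omega_limit_sub F A m (i * m) Fc cA Am x wx.
  by move=> [y Ay <-]; exists y => //; rewrite iterM.
move=> xA i i0; apply: (@subset_closure M); have [y Ay <-] := xA i I.
rewrite -iterM; exists (i * m)%N; last by exists y.
by rewrite /= leq_pmulr.
Qed.

Section TrappedAnnulus.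
Variables (F G : M -> M) (p : M) (e : E -> M) (c : M -> E) (m : nat) (s : R).
Hypothesis Fc : continuous F.
Hypothesis Gc : continuous G.
Hypothesis FK : cancel F G.
Hypothesis GK : cancel G F.
Hypothesis Fp : F p = p.
Hypothesis ech : cube_chart p e c.
Hypothesis m0 : (0 < m)%N.
Hypothesis s01 : 0 < s < 1.
Hypothesis Fcube : forall k z, (m <= k)%N -> cube z ->
  exists2 w, open_cube w & iter k F (e z) = e w.
Hypothesis Gball : forall k z, (m <= k)%N -> `|z| <= s ->
  exists2 w, `|w| < s & iter k G (e z) = e w.

Local Notation ann := (@annulus R n s).

Let s0 : 0 < s. Proof. by case/andP: s01. Qed.
Let s1 : s < 1. Proof. by case/andP: s01. Qed.

Let ce z : cube z -> c (e z) = z.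
Proof. by have [_ _ _ + _] := ech; apply. Qed.

Lemma annulus_cube z : ann z -> cube z.
Proof. by case/andP. Qed.

(** A point of the annulus that entered the inner cube under [F^k] would be
    brought back by [G^k] to a point of norm less than [s]. *)
Lemma trapped_annulus k z : (m <= k)%N -> ann z ->
  exists2 w, open_annulus s w & iter k F (e z) = e w.
Proof.
move=> mk Az; have [w Qw Fe] := Fcube mk (annulus_cube Az); exists w => //.
apply/andP; split=> //; rewrite ltNge; apply/negP => ws.
have [w' w's] := Gball mk ws; rewrite -Fe (iter_cancel k FK) => ew.
have Qw' : cube w' by rewrite /cube/=; exact: le_trans (ltW w's) (ltW s1).
have /andP[+ _] := Az.
by rewrite leNgt -(ce (annulus_cube Az)) ew (ce Qw') w's.
Qed.

(* The [m]-th power of [F] read in the chart, and its inverse. *)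
Let theta z := c (iter m F (e z)).
Let zeta z := c (iter m G (e z)).

Lemma chart_theta z : cube z -> e (theta z) = iter m F (e z).
Proof.
move=> Qz; have [w Qw Fe] := Fcube (leqnn m) Qz.
by rewrite /theta Fe ce//; exact: open_cube_cube.
Qed.

Lemma theta_open_cube z : cube z -> open_cube (theta z).
Proof.
move=> Qz; have [w Qw Fe] := Fcube (leqnn m) Qz.
by rewrite /theta Fe ce//; exact: open_cube_cube.
Qed.

Lemma theta_cube z : cube z -> cube (theta z).
Proof. by move=> /theta_open_cube/open_cube_cube. Qed.

Lemma theta_set_map : set_map cube cube theta.
Proof.
have [_ em cm _ _] := ech.
have Fm : set_map (e @` cube) (e @` cube) (iter m F).
  apply: set_map_at => [x _|_ [z Qz <-]]; first exact: iter_continuous.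
  by rewrite -chart_theta//; exists (theta z) => //; exact: theta_cube.
exact: set_map_comp (set_map_comp em Fm) cm.
Qed.

Lemma thetaK z : cube z -> zeta (theta z) = z.
Proof. by move=> Qz; rewrite /zeta chart_theta// (iter_cancel m FK) ce. Qed.

Lemma zeta_set_map : set_map (theta @` cube) cube zeta.
Proof.
have [_ em cm _ _] := ech.
have em' : set_map (theta @` cube) (iter m F @` (e @` cube)) e.
  split; last first.
    by move=> _ [z Qz <-]; exists (e z); [exists z|rewrite chart_theta].
  by apply: continuous_subspaceW em.1 => _ [z Qz <-]; exact: theta_cube.
have Gm : set_map (iter m F @` (e @` cube)) (e @` cube) (iter m G).
  apply: set_map_at => [x _|_ [x Qx <-]]; first exact: iter_continuous.
  by rewrite (iter_cancel m FK).
exact: set_map_comp (set_map_comp em' Gm) cm.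
Qed.

Lemma theta_fix : theta 0 = 0.
Proof.
have [e0 _ _ _ _] := ech; rewrite /theta e0 iter_fixed// -e0 ce//.
exact: cube0.
Qed.

Lemma iter_open k (O : set M) : open O -> open (iter k F @` O).
Proof.
move=> oO; rewrite (_ : _ @` _ = iter k G @^-1` O).
  by apply: open_comp => // x _; exact: iter_continuous.
apply/seteqP; split=> [_ [x Ox <-]|x Ox] /=; first by rewrite iter_cancel.
by exists (iter k G x) => //; rewrite (iter_cancel k GK).
Qed.

(** Openness passes through the manifold, where [F] is a homeomorphism. *)
Lemma theta_open (O : set E) : open O -> O `<=` open_cube -> open (theta @` O).
Proof.
move=> oO OQ; rewrite openE => _ [z Oz <-].
have Qz := theta_open_cube (open_cube_cube (OQ _ Oz)).
have [_ _ _ _ eo] := ech.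
have nW : nbhs (e (theta z)) (iter m F @` (e @` O)).
  apply: open_nbhs_nbhs; split; first by apply: iter_open; exact: eo.
  rewrite chart_theta; last exact/open_cube_cube/OQ.
  by exists (e z) => //; exists z.
have nO : nbhs (theta z) (e @^-1` (iter m F @` (e @` O))) := cube_chart_at ech
  Qz nW.
have nQ : nbhs (theta z) open_cube.
  by apply: open_nbhs_nbhs; split=> //; exact: open_cube_open.
change (nbhs (theta z) (theta @` O)).
apply: filterS2 nO nQ => y [_ [w Ow <-] ey] Qy; exists w => //.
by rewrite /theta ey ce//; exact: open_cube_cube.
Qed.

Lemma theta_annulus z : ann z -> open_annulus s (theta z).
Proof.
move=> Az; have [w Aw Fe] := trapped_annulus (leqnn m) Az.
by rewrite /theta Fe ce//; have /andP[_] := Aw; exact: ltW.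
Qed.

Lemma chart_iter_theta i z : cube z ->
  cube (iter i theta z) /\ e (iter i theta z) = iter i (iter m F) (e z).
Proof.
move=> Qz; elim: i => // i [Qi IH]; split; first exact: theta_cube.
by rewrite iterS chart_theta// IH.
Qed.

Let K := omega_limit F (e @` ann).

Lemma annulus_image_compact : compact (e @` ann).
Proof.
apply: (cube_chart_compact ech); first exact: annulus_compact.
exact: annulus_cube.
Qed.

Lemma annulus_image_trapped k x : (m <= k)%N ->
  (e @` ann) x -> (e @` ann) (iter k F x).
Proof.
move=> mk [z Az <-]; have [w /andP[sw w1] ->] := trapped_annulus mk Az.
by exists w => //; apply/andP; split; exact: ltW.
Qed.

Lemma omega_annulus_sub j : K `<=` iter j F @` (e @` ann).
Proof. exact: omega_limit_sub Fc annulus_image_compact annulus_image_trapped.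
Qed.

Lemma omega_annulus_attractor : attractor F K.
Proof.
split.
  apply: (subclosed_compact _ annulus_image_compact); last first.
    by move=> x /(omega_annulus_sub 0)[y Ay <-].
  by apply: closed_bigI => i _; exact: closed_closure.
exists (e @` ann); split=> // x /(omega_annulus_sub m)[_ [z Az <-] <-].
have [w Aw ->] := trapped_annulus (leqnn m) Az.
have [_ _ _ _ eo] := ech.
have : nbhs (e w) (e @` open_annulus s).
  apply: open_nbhs_nbhs; split; last by exists w.
  by apply: eo; [exact: open_annulus_open|move=> y /andP[]].
apply: filterS => _ [y /andP[sy y1] <-]; exists y => //.
by apply/andP; split; exact: ltW.
Qed.

Lemma omega_annulus_shape : same_shape R K (@unit_sphere R n).
Proof.
have [_ em cm _ _] := ech.
have Ksh : homeomorphic_sets K (\bigcap_i shell theta s i).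
  have KE : K = \bigcap_i (iter i (iter m F) @` (e @` ann)).
    exact: omega_limit_bigcap Fc m0 annulus_image_compact annulus_image_trapped.
  have Ke x : K x -> (e @` cube) x.
    by move=> /(omega_annulus_sub 0)[_ [z /annulus_cube Qz <-] <-]; exists z.
  have shQ y : (\bigcap_i shell theta s i) y -> cube y.
    by move=> /(_ 0%N I)[z /annulus_cube Qz <-].
  exists c, e; split.
  - split; first by apply: continuous_subspaceW cm.1 => x /Ke.
    move=> x Kx i _; move: Kx; rewrite KE => /(_ i I)[_ [z Az <-] <-].
    have [Qi <-] := chart_iter_theta i (annulus_cube Az); rewrite ce//.
    by exists z.
  - split; first by apply: continuous_subspaceW em.1 => y /shQ.
    move=> y sy; rewrite KE => i I'; have [z Az <-] := sy i I'.
    have [Qi ->] := chart_iter_theta i (annulus_cube Az); exists (e z) => //.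
  - by move=> x /Ke[z Qz <-]; rewrite ce.
  - by move=> y /shQ Qy; rewrite ce.
apply: (same_shape_homeomorphic Ksh (homeomorphic_refl (@unit_sphere R n))).
apply: (@annulus_shape R n theta zeta s s01 theta_set_map zeta_set_map thetaK
  theta_fix _ theta_open theta_annulus).
by move=> z /open_cube_cube/theta_open_cube.
Qed.

End TrappedAnnulus.

(** The tube lemma for the map sending [(x, l)] to the [k]-th iterate of [x]
    under [f l], which is jointly continuous. *)
Lemma parameter_tube (f : R -> M -> M) (D W : set M) k :
  {within setT `*` `[(0 : R), 1]%classic,
    continuous (fun xl : M * R => f xl.2 xl.1)} ->
  compact D -> open W -> (forall x, D x -> W (iter k (f 0) x)) ->
  \forall l \near (0 : R), 0 <= l <= 1 -> forall x, D x -> W (iter k (f l) x).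
Proof.
move=> fc cD oW DW; pose MI : set (M * R) := setT `*` `[(0 : R), 1]%classic.
have Phim : set_map MI setT (fun xl : M * R => iter k (f xl.2) xl.1).
  elim: (k) => [|j IH].
    by apply: set_map_at => // x _; exact: cvg_fst.
  have sndm : set_map MI `[(0 : R), 1]%classic (@snd M R).
    by apply: set_map_at => [x _|x []//]; exact: cvg_snd.
  have fm : set_map MI setT (fun xl : M * R => f xl.2 xl.1) by split.
  exact: set_map_comp (set_map_pair IH sndm) fm.
have : \forall l \near (0 : R),
    D `<=` (fun x => 0 <= l <= 1 -> W (iter k (f l) x)).
  apply: ((compact_near_coveringP D).1 cD R (nbhs (0 : R))
    (fun l x => 0 <= l <= 1 -> W (iter k (f l) x))) => x Dx.
  have /set_mapP[/(_ (x, 0)) Phic _] := Phim.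
  have nW : nbhs (iter k (f 0) x) W by apply: open_nbhs_nbhs; split=> //;
    exact: DW.
  have MI0 : MI (x, 0) by split=> //=; rewrite in_itv/= lexx ler01.
  have nP : nbhs (x, (0 : R)) (fun xl : M * R => MI xl ->
    W (iter k (f xl.2) xl.1)).
    exact: Phic MI0 _ nW.
  move: nP; apply: filterS => -[y l] /= H1 l01; apply: H1.
  by split=> //=; rewrite in_itv.
by apply: filterS => l H1 l01 x Dx; exact: H1.
Qed.

(** Every integer from [k0] on is a sum of integers between [k0] and [2 k0]. *)
Lemma iter_trapping (F : M -> M) (D D' : set M) k0 : (0 < k0)%N -> D' `<=` D ->
  (forall k x, (k0 <= k <= k0.*2)%N -> D x -> D' (iter k F x)) ->
  forall k x, (k0 <= k)%N -> D x -> D' (iter k F x).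
Proof.
move=> k00 DD Dk; elim/ltn_ind=> k IH x kk Dx.
have [k2|k2] := leqP k k0.*2; first by apply: Dk => //; rewrite kk.
rewrite -(subnK kk) iterD; apply: IH; [lia|lia|].
by apply/DD/Dk => //; lia.
Qed.

End Dynamics.

(** * The bifurcation *)

Section MainStep.
Variables (R : realType) (n : nat) (M : metricType R).
Local Notation E := 'rV[R]_n.
Local Notation cube := (@cube R n).
Local Notation open_cube := (@open_cube R n).
Hypothesis M_manifold : manifold n M.

(** The repeller condition is the trapping property for the inverse of [F] on a
    small cube; together with the trapping cube of [F] it bounds an annulus
    that is trapped by [F]. *)
Lemma sphere_attractor (F : M -> M) p (e : E -> M) c k0 :
  homeomorphism F -> repeller F [set p] -> cube_chart p e c ->
  (forall k x, (k0 <= k)%N -> (e @` cube) x -> (e @` open_cube) (iter k F x)) ->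
  exists K, [/\ attractor F K, same_shape R K (@unit_sphere R n) &
    forall j, K `<=` iter j F @` (e @` cube)].
Proof.
move=> [G' [Fc G'c FG' G'F]] [G [FG GF [_ [U [Up pU]]]]] ech Fe.
have Gc : continuous G.
  by rewrite (_ : G = G')//; apply/funext => x; rewrite -{1}(G'F x) FG.
have nU : nbhs p U by exact: (Up p).
have Gp : G p = p := omega_limit_fixed Gc pU.
have Fp : F p = p by rewrite -{1}Gp GF.
have [e0 _ _ ce _] := ech.
have e_at := cube_chart_at ech (@open_cube0 R n).
have nU0 : nbhs (0 : E) (e @^-1` U) by apply: e_at; rewrite e0.
have /nbhs_ballP[d /= d0 dU] := nU0.
(* The image of the cube of radius [s] lies in the neighbourhood [U] whose
   omega-limit under [G] is [p]. *)
pose s := Num.min d 1 / 2.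
have md0 : 0 < Num.min d 1 by rewrite lt_min d0 ltr01.
have md1 : Num.min d 1 <= 1 by rewrite ge_min lexx orbT.
have mdd : Num.min d 1 <= d by rewrite ge_min lexx.
have s0 : 0 < s by rewrite divr_gt0.
have s1 : s < 1 by rewrite /s; lra.
have sd : s < d by rewrite /s; lra.
have s01 : 0 < s < 1 by rewrite s0.
have s0le1 : 0 < s <= 1 by rewrite s0 ltW.
have sch := cube_chart_scale ech s0le1.
have sU z : cube z -> U (e (s *: z)).
  move=> Qz; apply: dU; rewrite -ball_normE/= sub0r normrN normrZ gtr0_norm//.
  by apply: le_lt_trans sd; rewrite ler_piMr// ltW.
have nB := cube_chart_nbhs sch (@open_cube_open R n) (@open_cube0 R n)
  (@subset_refl _ _).
have [k1 k1P] := omega_limit_attracts M_manifold Gc pU sch sU nB.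
pose m := (maxn k0 k1).+1.
have Fcube k z : (m <= k)%N -> cube z ->
    exists2 w, open_cube w & iter k F (e z) = e w.
  move=> mk Qz; have [|w Qw ew] := Fe k (e z) _ (imageP _ Qz); last by exists w.
  by move: mk; rewrite /m; lia.
have Gball k z : (m <= k)%N -> `|z| <= s ->
    exists2 w, `|w| < s & iter k G (e z) = e w.
  move=> mk zs; have Qz : cube (s^-1 *: z).
    by rewrite /cube/= normrZ gtr0_norm ?invr_gt0// mulrC ler_pdivrMr// mul1r.
  have mk1 : (k1 <= k)%N by move: mk; rewrite /m; lia.
  have sz : s *: (s^-1 *: z) = z by rewrite scalerA divff ?scale1r// gt_eqF.
  have := k1P k _ mk1 Qz; rewrite sz => -[w Qw ew].
  by exists (s *: w) => //; rewrite normrZ gtr0_norm// gtr_pMr.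
exists (omega_limit F (e @` @annulus R n s)); split.
- exact: (omega_annulus_attractor Fc FG ech s01 Fcube Gball).
- exact: (omega_annulus_shape Fc Gc FG GF Fp ech _ s01 Fcube Gball).
- move=> j x /(omega_annulus_sub Fc FG ech s01 Fcube Gball j).
  by move=> [_ [z /andP[_ z1] <-] <-]; exists (e z) => //; exists z.
Qed.

End MainStep.

Theorem theorem11 (R : realType) (n : nat) (M : metricType R)
  (f : R -> M -> M) (p : M)
  (M_manifold : manifold n M)
  (f_homeo : forall l : R, 0 <= l <= 1 -> homeomorphism (f l))
  (f_cont : {within setT `*` `[(0 : R), 1]%classic,
              continuous (fun xl : M * R => f xl.2 xl.1)})
  (p_stable : asymptotically_stable (f 0) p)
  (p_hopf : hopf_bifurcation f [set p]) :
  exists (l0 : R) (K : R -> set M),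
    [/\ 0 < l0 <= 1,
        forall l : R, 0 < l < l0 ->
          attractor (f l) (K l) /\ same_shape R (K l) (@unit_sphere R n) &
        usc_at_zero K [set p]].
Proof.
have [_ [_ [U [Up pU]]]] := p_stable; have [_ f_rep] := p_hopf.
have [_ [f0c _ _ _]] : homeomorphism (f 0) by apply: f_homeo;
  rewrite lexx ler01.
have nU : nbhs p U by exact: (Up p).
have [e [c [ech eU]]] := cube_chart_exists M_manifold nU.
have attr := omega_limit_attracts M_manifold f0c pU ech eU.
pose D := e @` @cube R n; pose D' := e @` @open_cube R n.
have D'D : D' `<=` D by apply: image_subset; exact: open_cube_cube.
have cD : compact D by apply: (cube_chart_compact ech) => //;
  exact: cube_compact.
have oD' : open D'.
  by have [_ _ _ _ eo] := ech; apply: eo => //; exact: open_cube_open.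
have nD' : nbhs p D'.
  exact: cube_chart_nbhs ech (@open_cube_open R n) (@open_cube0 R n)
    (@subset_refl _ _).
have [k1 k1P] := attr _ nD'; pose k0 := k1.+1.
have near_trap : \forall l \near (0 : R), forall k : 'I_k0.*2.+1, (k0 <= k)%N ->
    0 <= l <= 1 -> forall x, D x -> D' (iter k (f l) x).
  apply: (@filter_forall R _ (fun (k : 'I_k0.*2.+1) l => (k0 <= k)%N ->
    0 <= l <= 1 -> forall x, D x -> D' (iter k (f l) x)) (nbhs (0 : R))) => k.
  have [kk|kk] := leqP k0 k; last by apply: nearW.
  have kD x : D x -> D' (iter k (f 0) x).
    by move=> [z Qz <-]; apply: k1P => //; exact: ltnW.
  by apply: filterS (parameter_tube f_cont cD oD' kD) => l H _.
have /nbhs_ballP[d /= d0 dP] := near_trap.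
pose l0 := Num.min d 1.
have l00 : 0 < l0 by rewrite lt_min d0 ltr01.
have l01 : l0 <= 1 by rewrite ge_min lexx orbT.
have l0d : l0 <= d by rewrite ge_min lexx.
have trap l : 0 < l < l0 ->
    forall k x, (k0 <= k)%N -> D x -> D' (iter k (f l) x).
  move=> /andP[lp ll]; apply: (iter_trapping _ D'D) => // k x /andP[kk k2] Dx.
  have kO : (k < k0.*2.+1)%N by [].
  apply: (dP l _ (Ordinal kO)) => //=; last lra.
  by rewrite -ball_normE/= sub0r normrN gtr0_norm//; lra.
have /choice[K KP] : forall l, exists K : set M, 0 < l < l0 ->
    [/\ attractor (f l) K, same_shape R K (@unit_sphere R n) &
      forall j, K `<=` iter j (f l) @` D].
  move=> l; have [ll|nl] := boolP (0 < l < l0); last by exists set0.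
  have l1 : 0 < l <= 1 by lra.
  have hl : homeomorphism (f l) by apply: f_homeo; lra.
  have [K KP] := sphere_attractor M_manifold hl (f_rep l l1) ech (trap l ll).
  by exists K.
exists l0, K; split; first by rewrite l00.
  by move=> l /KP[].
move=> W pW; have nW : nbhs p W by exact: (pW p).
have [k kP] := attr _ (nbhs_interior nW).
have kD x : D x -> W° (iter k (f 0) x) by move=> [z Qz <-]; exact: kP.
have /nbhs_ballP[d' /= d'0 d'P] := parameter_tube f_cont cD (@open_interior _ W)
  kD.
exists (Num.min d' l0); first by rewrite lt_min d'0.
move=> l /andP[lp]; rewrite lt_min => /andP[ld ll] x.
have [|_ _ KD] := KP l; first by rewrite lp.
move=> /(KD k)[y Dy <-]; apply: interior_subset; apply: (d'P l) => //; last lra.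
by rewrite -ball_normE/= sub0r normrN gtr0_norm.
Qed.
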